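(* Let $F$ be a free group, and let $H$ and $K$ be nontrivial finitely generated subgroups of $F$ of ranks $h$ and $k\geq h$, respectively, that intersect nontrivially (i.e. $H\cap K\neq 1$). Then $$\operatorname{rank}(H\cap K) - 1 \;\leq\; 2(h-1)(k-1) - (h-1)\bigl(\operatorname{rank}(H\vee K) - 1\bigr).$$
   Context: For subgroups $H$ and $K$ of a free group, $H\vee K=\langle H,K\rangle$ denotes their join, i.e. the subgroup generated by $H\cup K$. The rank of a free group is the cardinality of a free basis; the trivial group has rank $0$. *)

(* Defs.v *)
From HB Require Import structures.
From mathcomp Require Import all_boot all_order all_algebra.
From mathcomp Require Import boolp classical_sets functions cardinality.

Set Implicit Arguments.
Unset Strict Implicit.
Unset Printing Implicit Defensive.

Local Open Scope group_scope.
Local Open Scope classical_set_scope.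
Local Open Scope card_scope.

Definition subgroup (G : groupType) (H : set G) : Prop :=
  group_closed (mem H).

Definition gen (G : groupType) (A : set G) : set G := smallest (@subgroup G) A.

Definition join (G : groupType) (H K : set G) : set G := gen (H `|` K).

Definition fin_gen (G : groupType) (H : set G) : Prop :=
  exists2 A : set G, finite_set A & gen A = H.

(* The letter (x, false) stands for x and (x, true) for its formal inverse. *)
Definition letter_val (G : groupType) (a : G * bool) : G :=
  if a.2 then a.1^-1 else a.1.

Definition word_val (G : groupType) (w : seq (G * bool)) : G :=
  \prod_(a <- w) letter_val a.

Definition reduced (T : eqType) (w : seq (T * bool)) : bool :=
  sorted (fun a b => b != (a.1, ~~ a.2)) w.

(* The reduced words over X are the elements of the free group on X. *)
Definition reduced_words (T : eqType) (X : set T) : set (seq (T * bool)) :=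
  [set w | reduced w /\ forall a, a \in w -> X a.1].

(* The canonical map from the free group on X to G is a bijection onto H;
   in particular X is contained in H and H is a subgroup. *)
Definition free_basis (G : groupType) (H X : set G) : Prop :=
  set_bij (reduced_words X) H (@word_val G).

Definition free_group (G : groupType) : Prop :=
  exists X : set G, free_basis [set: G] X.

(* "H is free of finite rank n", as a relation between H and n. *)
Definition has_rank (G : groupType) (H : set G) (n : nat) : Prop :=
  exists2 X : set G, free_basis H X & X #= `I_n.

(* Main.v *)
Require Import Defs.
From mathcomp Require Import all_boot all_order all_algebra.
From mathcomp Require Import ring zify.
From mathcomp Require Import boolp classical_sets functions cardinality.

Set Implicit Arguments.
Unset Strict Implicit.
Unset Printing Implicit Defensive.
Import GRing.Theory.

(* Kent's argument.  Over a free basis of J = H \/ K, conjugated so that H /\ K contains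
   a nontrivial cyclically reduced word, the subgroups H, K and H /\ K are read off finite
   core graphs A, B, C with all degrees at least 2, and C maps to A and B.  Replacing every
   vertex by a path turns them into graphs with degrees 2 and 3, whose number of vertices
   of degree 3 is 2 (rank - 1).  The vertices of degree 3 of C form a relation between
   those of A and those of B.  The coequalizer of the two maps from C to the disjoint union
   of A and B has a fundamental group that maps onto J, so minus its Euler characteristic
   is at least rank J - 1; on the other hand, twice that number is at most the number of
   classes generated by the relation.  A relation with 2 (rank J - 1) classes misses
   enough pairs to give the bound.  Dimensions of spaces of cochains are replaced by
   cardinalities of sets of F_2-valued functions. *)

(** * Words and free families *)

(** The rank of the join enters through the alphabet. Over a basis [T] of J a homomorphism to the
    field with two elements is an arbitrary [phi] on [T], and J being generated by [H] and [K] means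
    that a [phi] killing both is zero. This dual form of surjectivity stands in for the fundamental
    group of the coequalizer.

    The obstacle is that the coequalizer may have vertices of high degree: two trivalent vertices
    glued through a bivalent one keep separate third ends. Counting functions on ends copes with
    this. Those with zero sum at trivalent vertices are fixed by two values per vertex of the
    coequalizer, since every link carries at least two ends; the sums cost one bit per class of
    trivalent vertices under trivalent links.

    Constants: all pairs of trivalent vertices number 4(h-1)(k-1), against 2(r-1) for those of C,
    where r is the rank of the intersection. With t = 2(j-1) classes, j the rank of J, a trivalent
    vertex of A misses at least t/2 = j-1 partners on average; there are 2(h-1) such vertices.
    Halving gives the bound. *)

Arguments reduced : simpl never.

Section Words.
Variable T : eqType.
Implicit Types (a : T * bool) (u v w r : seq (T * bool)).

Definition linv a : T * bool := (a.1, ~~ a.2).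

Definition winv w := rev (map linv w).

Definition push a r :=
  if r is b :: r' then if b == linv a then r' else a :: r else [:: a].

Definition red w := foldr push [::] w.

Lemma linvK : involutive linv.
Proof. by case=> x b; rewrite /linv /= negbK. Qed.

Lemma linv_neq a : (linv a == a) = false.
Proof. by case: a => x [] /=; apply/eqP => -[]. Qed.

Lemma winv_cons a w : winv (a :: w) = rcons (winv w) (linv a).
Proof. by rewrite /winv /= rev_cons. Qed.

Lemma winv_cat u v : winv (u ++ v) = winv v ++ winv u.
Proof. by rewrite /winv map_cat rev_cat. Qed.

Lemma reduced_cons a w :
  reduced (a :: w) = (if w is b :: _ then b != linv a else true) && reduced w.
Proof. by case: w. Qed.

Lemma reduced_cat u v :
  reduced (u ++ v) -> reduced u /\ reduced v.
Proof.
elim: u => [|a u IH] //; rewrite cat_cons !reduced_cons => /andP[auv /IH[-> ->]].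
by case: u auv {IH} => //= b u ->.
Qed.

Lemma reduced_winv w : reduced (winv w) = reduced w.
Proof.
rewrite /reduced /winv rev_sorted sorted_map.
apply: eq_sorted => -[x c] [y d] /=.
by rewrite /linv /= negbK eq_sym.
Qed.

Lemma push_reduced a r : reduced r -> reduced (push a r).
Proof.
case: r => [|b r] // rr; rewrite /push; case: ifP => [_|/negbT ba].
  by move: rr; rewrite reduced_cons => /andP[].
by rewrite reduced_cons ba.
Qed.

Lemma foldr_push_reduced r w : reduced r -> reduced (foldr push r w).
Proof. by move=> rr; elim: w => [|a w IH] //=; apply: push_reduced. Qed.

Lemma red_reduced w : reduced (red w).
Proof. exact: foldr_push_reduced. Qed.

Lemma red_id w : reduced w -> red w = w.
Proof.
elim: w => [|a w IH] //=; rewrite reduced_cons => /andP[aw /IH ->].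
by case: w aw {IH} => [|b w] //= /negbTE ->.
Qed.

Lemma pushK a r : reduced r -> push (linv a) (push a r) = r.
Proof.
case: r => [|b r] rr /=; first by rewrite linvK eqxx.
case: ifP => [/eqP ba|_]; last by rewrite /= linvK eqxx.
case: r rr => [|c r] /=; first by rewrite ba.
by rewrite ba linvK => /andP[/negbTE]; rewrite -/(linv (linv a)) linvK => ->.
Qed.

Lemma red_catr u v : red (u ++ red v) = red (u ++ v).
Proof. by rewrite /red !foldr_cat -!/(red _) red_id ?red_reduced. Qed.

End Words.

Section FreeFamily.
Local Open Scope group_scope.
Variable G : groupType.

Section Value.
Variables (T : eqType) (b : T -> G).

Definition fval (w : seq (T * bool)) : G :=
  \prod_(a <- w) letter_val (b a.1, a.2).

Lemma fval_nil : fval [::] = 1.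
Proof. exact: big_nil. Qed.

Lemma fval_cons a w : fval (a :: w) = letter_val (b a.1, a.2) * fval w.
Proof. exact: big_cons. Qed.

Lemma fval_cat u v : fval (u ++ v) = fval u * fval v.
Proof. exact: big_cat. Qed.

Lemma letter_val_linv a :
  letter_val (b (linv a).1, (linv a).2) = (letter_val (b a.1, a.2))^-1.
Proof. by case: a => x [] /=; rewrite /letter_val /= ?invgK. Qed.

Lemma fval1 a : fval [:: a] = letter_val (b a.1, a.2).
Proof. by rewrite fval_cons fval_nil mulg1. Qed.

Lemma fval_winv w : fval (winv w) = (fval w)^-1.
Proof.
elim: w => [|a w IH]; first by rewrite fval_nil invg1.
by rewrite winv_cons -cats1 fval_cat fval_cons fval_nil mulg1 letter_val_linv IH
  fval_cons invgM.
Qed.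

Lemma fval_push a r : fval (push a r) = letter_val (b a.1, a.2) * fval r.
Proof.
case: r => [|c r] /=; first by rewrite fval_cons.
case: ifP => [/eqP ->|_]; last by rewrite fval_cons.
by rewrite fval_cons letter_val_linv mulgA mulgV mul1g.
Qed.

Lemma fval_red w : fval (red w) = fval w.
Proof. by elim: w => [|a w IH] //=; rewrite fval_push IH fval_cons. Qed.

Definition free_words :=
  forall u v, reduced u -> reduced v -> fval u = fval v -> u = v.

(** Indexed form of [free_basis]: with a finite index type, the basis itself can serve as the
    alphabet of a graph. *)
Definition free_family (H : set G) :=
  free_words /\ forall g, H g <-> exists w, fval w = g.

Lemma free_words_inj : free_words -> injective b.
Proof.
move=> fw x y bxy; have: [:: (x, false)] = [:: (y, false)].
  by apply: fw; rewrite // /fval !big_seq1 /letter_val.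
by case.
Qed.

Lemma free_words_red : free_words ->
  forall u v, fval u = fval v -> red u = red v.
Proof. by move=> fw u v uv; apply: fw; rewrite ?red_reduced // !fval_red. Qed.

Definition wmap (w : seq (T * bool)) : seq (G * bool) :=
  [seq (b a.1, a.2) | a <- w].

Lemma word_val_wmap w : word_val (wmap w) = fval w.
Proof. by rewrite /word_val big_map. Qed.

Lemma reduced_wmap w : injective b -> reduced (wmap w) = reduced w.
Proof.
move=> bI; rewrite /reduced sorted_map; apply: eq_sorted => x y /=.
by rewrite -!pair_eqE /= (inj_eq bI).
Qed.

Lemma wmap_inj : injective b -> injective wmap.
Proof. by move=> bI; apply: inj_map => -[x c] [y d] [/bI -> ->]. Qed.

Lemma wmap_onto (w : seq (G * bool)) :
  (forall a, a \in w -> exists x, b x = a.1) -> exists w', wmap w' = w.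
Proof.
elim: w => [|a w IH] Hw; first by exists [::].
have [|w' Ew] := IH; first by move=> c cw; apply: Hw; rewrite inE cw orbT.
have [x Ex] := Hw a (mem_head _ _).
by exists ((x, a.2) :: w'); rewrite /= Ew Ex; case: (a).
Qed.

Lemma free_family_basis H : free_family H -> free_basis H (range b).
Proof.
move=> [fw HH]; have bI := free_words_inj fw.
have onto w : reduced_words (range b) w -> exists2 w', reduced w' & wmap w' = w.
  move=> [rw Hw]; have [|w' Ew] := @wmap_onto w.
    by move=> a /Hw [x _ <-]; exists x.
  by exists w' => //; rewrite -(reduced_wmap _ bI) Ew.
split.
- by move=> _ /onto[w _ <-] /=; rewrite word_val_wmap; apply/HH; exists w.
- move=> _ _ /set_mem /onto[u ru <-] /set_mem /onto[v rv <-].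
  by rewrite !word_val_wmap => /(fw _ _ ru rv) ->.
- move=> g /HH [w <-]; exists (wmap (red w)); last by rewrite word_val_wmap fval_red.
  split; first by rewrite (reduced_wmap _ bI) red_reduced.
  by move=> a /mapP[x _ ->]; exists x.1.
Qed.

Lemma basis_free_words H X : free_basis H X -> injective b ->
  (forall x, X (b x)) -> free_words.
Proof.
move=> [_ inj _] bI bX u v ru rv uv; apply: (wmap_inj bI).
have rX w : reduced w -> wmap w \in reduced_words X.
  move=> rw; apply/mem_set; split; first by rewrite reduced_wmap.
  by move=> a /mapP[x _ ->]; exact: bX.
by apply: inj; rewrite ?rX // !word_val_wmap.
Qed.

End Value.

Lemma basis_free_family (T : eqType) (b : T -> G) H X :
  free_basis H X -> injective b -> (forall x, X (b x)) ->
  (forall g, X g -> exists x, b x = g) -> free_family b H.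
Proof.
move=> fb bI bX Xb; split; first exact: (basis_free_words fb).
have [Hfun _ Hsurj] := fb => g; split.
  move=> /Hsurj[w [rw Hw] <-].
  have [|w' <-] := @wmap_onto _ b w; first by move=> a /Hw /Xb.
  by exists w'; rewrite word_val_wmap.
case=> w <-; rewrite -fval_red -word_val_wmap; apply: Hfun; split.
  by rewrite reduced_wmap // red_reduced.
by move=> a /mapP[x _ ->]; exact: bX.
Qed.

Lemma free_family_rank (T : finType) (b : T -> G) H :
  free_family b H -> has_rank H #|T|.
Proof.
move=> fH; exists (range b); first exact: free_family_basis.
have bI := free_words_inj (proj1 fH).
apply/card_set_bijP; exists (fun g => if [pick x | b x == g] is Some x
  then enum_rank x : nat else 0).
have pk x : [pick y | b y == b x] = Some x.
  by case: pickP => [y /eqP/bI -> //|/(_ x)]; rewrite eqxx.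
split.
- by move=> _ [x _ <-] /=; rewrite pk ltn_ord.
- move=> _ _ /set_mem [x _ <-] /set_mem [y _ <-]; rewrite !pk => /ord_inj.
  by move/enum_rank_inj ->.
- move=> n /= nT; exists (b (enum_val (Ordinal nT))); first by exists (enum_val (Ordinal nT)).
  by rewrite pk enum_valK.
Qed.

Lemma rank_free_family H n :
  has_rank H n -> exists b : 'I_n -> G, free_family b H.
Proof.
move=> [X fb /card_set_bijP[f [ffun finj fsurj]]].
have /boolp.choice[b Hb] : forall i : 'I_n, exists x, X x /\ f x = i.
  by move=> i; have [x Xx <-] := fsurj i (ltn_ord i); exists x.
exists b; apply: (basis_free_family fb).
- by move=> i j bij; apply/ord_inj; rewrite -(proj2 (Hb i)) -(proj2 (Hb j)) bij.
- by move=> i; case: (Hb i).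
- move=> g Xg; exists (Ordinal (ffun g Xg : f g < n)).
  have [Xi fi] := Hb (Ordinal (ffun g Xg : f g < n)).
  by apply: finj => //; exact: mem_set.
Qed.

End FreeFamily.

(** * Homomorphisms to F_2 and invariance of the rank *)

Section Parity.
Local Open Scope ring_scope.

Lemma addF2 (x : 'F_2) : x + x = 0.
Proof. by apply: val_inj; case: x => [[|[|]]]. Qed.

Lemma addF2_eq0 (x y : 'F_2) : (x + y == 0) = (x == y).
Proof. by rewrite -(addF2 y) (inj_eq (addIr y)). Qed.

Variables (T : eqType).
Implicit Types (f : T -> 'F_2) (u v w : seq (T * bool)).

(** Modulo 2 a letter and its inverse count alike, so this is a homomorphism on the free group
    without any signs. *)
Definition wsum f w := \sum_(a <- w) f a.1.

Lemma wsum_nil f : wsum f [::] = 0.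
Proof. exact: big_nil. Qed.

Lemma wsum_cons f a w : wsum f (a :: w) = f a.1 + wsum f w.
Proof. exact: big_cons. Qed.

Lemma wsum_cat f u v : wsum f (u ++ v) = wsum f u + wsum f v.
Proof. exact: big_cat. Qed.

Lemma wsum_winv f w : wsum f (winv w) = wsum f w.
Proof.
elim: w => [|a w IH] //.
by rewrite winv_cons -cats1 wsum_cat IH !wsum_cons wsum_nil addr0 addrC.
Qed.

Lemma wsum_push f a w : wsum f (push a w) = f a.1 + wsum f w.
Proof.
case: w => [|c w] /=; first by rewrite wsum_cons.
case: ifP => [/eqP ->|_]; last by rewrite wsum_cons.
by rewrite wsum_cons addrA addF2 add0r.
Qed.

Lemma wsum_red f w : wsum f (red w) = wsum f w.
Proof. by elim: w => [|a w IH] //=; rewrite wsum_push IH wsum_cons. Qed.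

End Parity.

Section Substitution.
Variables (T U : eqType) (s : U -> seq (T * bool)).

Definition wsubst (w : seq (U * bool)) : seq (T * bool) :=
  flatten [seq if a.2 then winv (s a.1) else s a.1 | a <- w].

Lemma wsum_wsubst (f : T -> 'F_2) w :
  wsum f (wsubst w) = wsum (fun u => wsum f (s u)) w.
Proof.
elim: w => [|[u c] w IH]; first by rewrite /wsubst /= !wsum_nil.
rewrite /wsubst /= wsum_cat -/(wsubst w) IH wsum_cons /=.
by case: c; rewrite ?wsum_winv.
Qed.

Lemma fval_wsubst (G : groupType) (b : T -> G) w :
  fval b (wsubst w) = fval (fun u => fval b (s u)) w.
Proof.
elim: w => [|[u c] w IH]; first by rewrite /wsubst /= !fval_nil.
rewrite /wsubst /= fval_cat -/(wsubst w) IH fval_cons /letter_val /=.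
by case: c; rewrite ?fval_winv.
Qed.

End Substitution.

Lemma eq_fval (T : eqType) (G : groupType) (b c : T -> G) : b =1 c -> fval b =1 fval c.
Proof. by move=> bc w; apply: eq_bigr => a _; rewrite bc. Qed.

(* A homomorphism to F_2 is determined by its values on the generators [c],
   and takes arbitrary values on the free family [b]. *)
Lemma free_family_le (G : groupType) (T U : finType) (b : T -> G) (c : U -> G) H :
  free_family b H -> (forall u, H (c u)) ->
  (forall g, H g -> exists w, fval c w = g) -> #|T| <= #|U|.
Proof.
move=> [fw HH] Hc cH.
have /boolp.choice[s sE] : forall u, exists w, fval b w = c u.
  by move=> u; apply/HH.
have fvalE w : fval b (wsubst s w) = fval c w.
  by rewrite fval_wsubst; apply: eq_fval.
pose Phi (f : {ffun T -> 'F_2}) : {ffun U -> 'F_2} := [ffun u => wsum f (s u)].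
suff /leq_card : injective Phi by rewrite !card_ffun card_Fp // leq_exp2l.
have PhiE (f : {ffun T -> 'F_2}) w : wsum f (wsubst s w) = wsum (Phi f) w.
  by rewrite wsum_wsubst; apply: eq_bigr => a _; rewrite ffunE.
move=> f f' ff'; apply/ffunP => t.
have [|w Ew] := cH (b t); first by apply/HH; exists [:: (t, false)]; rewrite fval1.
have Er : red (wsubst s w) = [:: (t, false)].
  rewrite -[RHS](@red_id _ [:: (t, false)]) //.
  by apply: (free_words_red fw); rewrite fvalE Ew fval1.
have val_t (g : {ffun T -> 'F_2}) : g t = wsum (Phi g) w.
  by rewrite -PhiE -wsum_red Er /wsum big_seq1.
by rewrite !val_t ff'.
Qed.

Lemma free_family_card (G : groupType) (T U : finType) (b : T -> G) (c : U -> G) H :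
  free_family b H -> free_family c H -> #|T| = #|U|.
Proof.
have mem (V : finType) (d : V -> G) : free_family d H -> forall v, H (d v).
  by move=> [_ dH] v; apply/dH; exists [:: (v, false)]; rewrite fval1.
move=> bH cH; apply/eqP; rewrite eqn_leq; apply/andP; split.
  by apply: (free_family_le bH (mem _ _ cH)) => g /(proj2 cH).
by apply: (free_family_le cH (mem _ _ bH)) => g /(proj2 bH).
Qed.

Lemma has_rank_card (G : groupType) (T : finType) (b : T -> G) H n :
  free_family b H -> has_rank H n -> n = #|T|.
Proof.
move=> bH /rank_free_family[c cH].
by rewrite -(free_family_card cH bH) card_ord.
Qed.

(** * Graphs labelled by letters, and free bases from spanning trees *)

(* The value of [tgt v a] is irrelevant when [edge v a] fails. *)
Record graph (T : eqType) := Graph {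
  vert :> finType;
  edge : vert -> T * bool -> bool;
  tgt : vert -> T * bool -> vert;
  edge_linv : forall v a, edge v a -> edge (tgt v a) (linv a);
  tgtK : forall v a, edge v a -> tgt (tgt v a) (linv a) = v }.

Arguments edge {T g}.
Arguments tgt {T g}.

Section Paths.
Variables (T : eqType) (A : graph T).
Implicit Types (v : A) (a : T * bool) (u w : seq (T * bool)).

Fixpoint ok v w := if w is a :: w' then edge v a && ok (tgt v a) w' else true.

Definition run v w := foldl tgt v w.

Definition accepts v w := ok v w && (run v w == v).

Lemma ok_cat v u w : ok v (u ++ w) = ok v u && ok (run v u) w.
Proof. by elim: u v => [|a u IH] v //=; rewrite IH andbA. Qed.

Lemma run_cat v u w : run v (u ++ w) = run (run v u) w.
Proof. exact: foldl_cat. Qed.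

Lemma ok_rcons v w a : ok v (rcons w a) = ok v w && edge (run v w) a.
Proof. by rewrite -cats1 ok_cat /= andbT. Qed.

Lemma run_rcons v w a : run v (rcons w a) = tgt (run v w) a.
Proof. by rewrite -cats1 run_cat. Qed.

Lemma run_winv v w : ok v w -> run (run v w) (winv w) = v.
Proof.
elim: w v => [|a w IH] v //= /andP[va /IH IHw].
by rewrite winv_cons run_rcons IHw tgtK.
Qed.

Lemma ok_winv v w : ok v w -> ok (run v w) (winv w).
Proof.
elim: w v => [|a w IH] v //= /andP[va okw].
by rewrite winv_cons ok_rcons IH //= run_winv // edge_linv.
Qed.

Lemma ok_push v a r : ok v (a :: r) ->
  ok v (push a r) /\ run v (push a r) = run v (a :: r).
Proof.
case: r => [|c r] // H; rewrite /push; case: ifP => // /eqP E.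
by move: H; rewrite E /= => /and3P[va _]; rewrite tgtK.
Qed.

Lemma ok_red v w : ok v w -> ok v (red w) /\ run v (red w) = run v w.
Proof.
elim: w v => [|a w IH] v //= /andP[va /IH[okw runw]].
have [|-> ->] := @ok_push v a (red w); first by rewrite /= va.
by rewrite /= runw.
Qed.

Lemma accepts_cat v u w : accepts v u -> accepts v w -> accepts v (u ++ w).
Proof.
by move=> /andP[u1 /eqP u2] /andP[w1 /eqP w2]; rewrite /accepts ok_cat run_cat
  u1 u2 w1 w2 /=.
Qed.

Lemma accepts_winv v w : accepts v w -> accepts v (winv w).
Proof.
move=> /andP[okw /eqP E]; have := ok_winv okw; have := run_winv okw.
by rewrite /accepts E => -> ->; rewrite eqxx.
Qed.

Lemma accepts_red v w : accepts v w -> accepts v (red w).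
Proof. by move=> /andP[/ok_red[E1 E2] H]; rewrite /accepts E1 E2. Qed.

Lemma accepts_wsubst (U : eqType) (s : U -> seq (T * bool)) v (w : seq (U * bool)) :
  (forall y, accepts v (s y)) -> accepts v (wsubst s w).
Proof.
move=> acc; elim: w => [|[y []] w IH]; first by rewrite /accepts /=.
  by apply: accepts_cat; [apply: accepts_winv; apply: acc | apply: IH].
by apply: accepts_cat; [apply: acc | apply: IH].
Qed.

Definition connected v0 := forall v, exists2 w, ok v0 w & run v0 w = v.

(** This is the core condition relative to a base point. For a connected graph it leaves only [v0]
    as a possible vertex of degree less than 2. *)
Definition trim v0 := forall v a, edge v a ->
  exists u w, [/\ reduced (u ++ a :: w), accepts v0 (u ++ a :: w) & run v0 u = v].

Variables (G : groupType) (b : T -> G).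

(** Restricted to reduced words, because an unreduced word with value in [H] may leave a finite
    graph. *)
Definition recognizes v0 (H : set G) :=
  forall w, reduced w -> (H (fval b w) <-> accepts v0 w).

Lemma recognizes_accepts v0 H w : recognizes v0 H -> accepts v0 w -> H (fval b w).
Proof.
by move=> rec /accepts_red acc; rewrite -fval_red; apply/rec; rewrite ?red_reduced.
Qed.

End Paths.

Section SpanningTree.
Variables (T : finType) (A : graph T) (v0 : A) (Aconn : connected v0).
Implicit Types (v u : A) (a : T * bool) (w : seq (T * bool)).

Let path_size v n := `[< exists w, [/\ size w = n, ok v0 w & run v0 w = v] >].

Fact path_size_ex v : exists n, path_size v n.
Proof. by have [w okw Ew] := Aconn v; exists (size w); apply/asboolP; exists w. Qed.

Definition dist v := ex_minn (path_size_ex v).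

Lemma dist_path v : exists w, [/\ size w = dist v, ok v0 w & run v0 w = v].
Proof. by rewrite /dist; case: ex_minnP => n /asboolP. Qed.

Lemma dist_min w : ok v0 w -> dist (run v0 w) <= size w.
Proof.
move=> okw; rewrite /dist; case: ex_minnP => n _; apply.
by apply/asboolP; exists w.
Qed.

(** Any choice of a strictly closer neighbour gives a spanning tree; the decreasing distance rules
    out cycles and supports induction. *)
Definition parent v := [pick a | edge v a && (dist (tgt v a) < dist v)].

Lemma parent_edge v a : parent v = Some a -> edge v a /\ dist (tgt v a) < dist v.
Proof. by rewrite /parent; case: pickP => // c /andP[ec dc] [<-]. Qed.

Lemma parent_base : parent v0 = None.
Proof.
case E: (parent v0) => [a|] //; have [_] := parent_edge E.
by move/leq_trans/(_ (@dist_min [::] isT)).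
Qed.

Lemma parentP v : v != v0 -> exists a, parent v = Some a.
Proof.
rewrite /parent; case: pickP => [a _ _|none]; first by exists a.
have [w [sw okw rw]] := dist_path v.
case/lastP: w sw okw rw => [|w c]; first by move=> _ _ <-; rewrite eqxx.
rewrite size_rcons ok_rcons run_rcons => sw /andP[okw ec] rw.
have /negP[] := negbT (none (linv c)).
by rewrite -rw edge_linv // tgtK //= rw -sw ltnS dist_min.
Qed.

Fixpoint tree_path_rec n v :=
  if n is n'.+1 then
    if parent v is Some a then rcons (tree_path_rec n' (tgt v a)) (linv a) else [::]
  else [::].

Definition tree_path v := tree_path_rec (dist v) v.

Lemma tree_path_rec_stable n m v : dist v <= n -> dist v <= m ->
  tree_path_rec n v = tree_path_rec m v.
Proof.
elim: n m v => [|n IH] [|m] v //=.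
- rewrite leqn0 => /eqP d0 _; case E: (parent v) => [a|] //.
  by have [_] := parent_edge E; rewrite d0.
- rewrite leqn0 => _ /eqP d0; case E: (parent v) => [a|] //.
  by have [_] := parent_edge E; rewrite d0.
- case E: (parent v) => [a|] // dn dm; have [_ da] := parent_edge E.
  by rewrite (IH m) // -ltnS (leq_trans da).
Qed.

Lemma tree_pathE v :
  tree_path v = if parent v is Some a then rcons (tree_path (tgt v a)) (linv a) else [::].
Proof.
rewrite /tree_path (tree_path_rec_stable (leqnn _) (leqnSn _)) /=.
case E: (parent v) => [a|] //; have [_ da] := parent_edge E.
by rewrite (tree_path_rec_stable (ltnW da) (leqnn _)).
Qed.

Lemma dist_ind (P : A -> Prop) :
  (forall v, (forall a, parent v = Some a -> P (tgt v a)) -> P v) -> forall v, P v.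
Proof.
move=> step v; have [n] := ubnP (dist v); elim: n v => [|n IH] v // dv.
by apply: step => a /parent_edge[_ da]; apply: IH; apply: leq_trans da _.
Qed.

Lemma tree_path_ok v : ok v0 (tree_path v) /\ run v0 (tree_path v) = v.
Proof.
elim/dist_ind: v => v IH; rewrite tree_pathE.
case E: (parent v) IH => [a|] IH; last first.
  by have [//|/parentP[a]] := eqVneq v v0; rewrite E.
have [[ok_a run_a] [ea _]] := (IH a erefl, parent_edge E).
by rewrite ok_rcons run_rcons ok_a run_a edge_linv // tgtK.
Qed.

Definition tree_edge v a := (parent v == Some a) || (parent (tgt v a) == Some (linv a)).

Lemma tree_edge_linv v a : edge v a -> tree_edge (tgt v a) (linv a) = tree_edge v a.
Proof. by move=> ea; rewrite /tree_edge tgtK // linvK orbC. Qed.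

Definition pos_edges := [set vx : A * T | edge vx.1 (vx.2, false)].

Definition off_tree (vx : A * T) := (vx \in pos_edges) && ~~ tree_edge vx.1 (vx.2, false).

(** The same edge, traversed in the direction of its positive letter, so that each edge has one
    name. *)
Definition pos_of v a : A * T := if a.2 then (tgt v a, a.1) else (v, a.1).

(** Sending a vertex other than [v0] to its parent edge is a bijection onto the tree edges, so the
    tree has one edge fewer than there are vertices. *)
Lemma card_off_tree : #|{: {vx | off_tree vx}}| + #|A| = #|pos_edges|.+1.
Proof.
rewrite card_sig.
have -> : #|[pred vx | off_tree vx]|
    = #|pos_edges :\: [set vx : A * T | tree_edge vx.1 (vx.2, false)]|.
  by apply: eq_card => vx; rewrite [RHS]inE inE /off_tree inE andbC.
rewrite -(cardsID [set vx : A * T | tree_edge vx.1 (vx.2, false)] pos_edges).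
rewrite -addSn addnC; congr (_ + _)%N.
rewrite -cardsT (cardsD1 v0) inE add1n; congr _.+1.
pose pe v := omap (pos_of v) (parent v).
(* If two vertices shared a parent edge in opposite directions, each would be strictly closer to
   [v0] than the other. *)
have peI : {in [set~ v0] &, injective pe}.
  move=> v u; rewrite !inE => /parentP[a Ea] /parentP[c Ec].
  rewrite /pe Ea Ec /= /pos_of => -[].
  have [[ea da] [ec dc]] := (parent_edge Ea, parent_edge Ec).
  case: a c Ea Ec ea ec da dc => x [] [y []] /= Ea Ec ea ec da dc [].
  - by move=> E xy; rewrite -(tgtK ea) -(tgtK ec) E xy.
  - move=> E xy; move: dc; rewrite -E -xy -[(x, false)]/(linv (x, true)) tgtK //.
    by rewrite ltnNge ltnW // E.
  - move=> E xy; move: da; rewrite E xy -[(y, false)]/(linv (y, true)) tgtK //.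
    by rewrite ltnNge ltnW // -E.
  - by [].
have -> : #|[set: A] :\ v0| = #|[set~ v0]|.
  by apply: eq_card => v; rewrite !inE andbT.
rewrite -(card_in_imset peI) -(card_imset (pos_edges :&: _) (@Some_inj _)).
apply: eq_card => o; apply/imsetP/imsetP => [[v] | [[v x]]].
  rewrite !inE => /parentP[a Ea] ->; have [ea _] := parent_edge Ea.
  exists (pos_of v a); last by rewrite /pe Ea.
  case: a Ea ea => x [] Ea ea; rewrite !inE /pos_of /=.
    rewrite -[(x, false)]/(linv (x, true)) edge_linv //= tree_edge_linv //.
    by rewrite /tree_edge Ea eqxx.
  by rewrite ea /tree_edge Ea eqxx.
have nv0 u c : parent u = Some c -> u \in [set~ v0].
  by move=> Ec; rewrite !inE; apply: contra_eq_neq Ec => ->; rewrite parent_base.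
rewrite !inE /= => /andP[ev /orP[/eqP Ev|/eqP Ev] ->].
  by exists v; rewrite ?(nv0 _ _ Ev) // /pe Ev.
exists (tgt v (x, false)); first exact: nv0 Ev.
by rewrite /pe Ev /= /pos_of /= tgtK.
Qed.
End SpanningTree.

Lemma red_cancel (T : eqType) (u w : seq (T * bool)) : red (u ++ winv u ++ w) = red w.
Proof.
elim: u w => [|a u IH] w //; rewrite winv_cons cat_rcons /= IH /=.
by rewrite -{1}[a]linvK pushK // red_reduced.
Qed.

Section NielsenSchreier.
Local Open Scope group_scope.
Variables (T : finType) (A : graph T) (v0 : A) (Aconn : connected v0).
Implicit Types (v u : A) (a : T * bool) (w : seq (T * bool)).

Local Notation gens := {vx | off_tree Aconn vx}.

(* The generators read along a single edge: none on the tree, one off it. *)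
Definition read1 v a : seq (gens * bool) :=
  if insub (pos_of v a) is Some y then [:: (y, a.2)] else [::].

Fixpoint read v w := if w is a :: w' then read1 v a ++ read (tgt v a) w' else [::].

Lemma read_cat v w1 w2 : read v (w1 ++ w2) = read v w1 ++ read (run v w1) w2.
Proof. by elim: w1 v => [|a w1 IH] v //=; rewrite IH catA. Qed.

Lemma read1_tree v a : edge v a -> tree_edge Aconn v a -> read1 v a = [::].
Proof.
move=> ea ta; rewrite /read1; case: insubP => // y; rewrite /off_tree /pos_of.
case: a ea ta => x [] ea ta /andP[_ /negP[]] //=.
by rewrite -[(x, false)]/(linv (x, true)) tree_edge_linv.
Qed.

Lemma read1_linv v a : edge v a -> read1 (tgt v a) (linv a) = winv (read1 v a).
Proof.
move=> ea; rewrite /read1.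
have -> : pos_of (tgt v a) (linv a) = pos_of v a.
  by rewrite /pos_of; case: a ea => x [] ea //=; rewrite (tgtK ea).
by case: insubP.
Qed.

Lemma read_winv v w : ok v w -> read (run v w) (winv w) = winv (read v w).
Proof.
elim: w v => [|a w IH] v //= /andP[ea okw].
by rewrite winv_cons -cats1 read_cat IH // run_winv //= cats0 read1_linv // winv_cat.
Qed.

Lemma read_push v a w : ok v (a :: w) -> red (read v (push a w)) = red (read v (a :: w)).
Proof.
case: w => [|c w] // H; rewrite /push; case: ifP => // /eqP Ec.
move: H; rewrite Ec /= => /andP[ea _].
by rewrite read1_linv // tgtK // red_cancel.
Qed.

Lemma read_red v w : ok v w -> red (read v (red w)) = red (read v w).
Proof.
elim: w v => [|a w IH] v //= /andP[ea okw].
rewrite read_push; last by rewrite /= ea (proj1 (ok_red okw)).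
by rewrite /= -red_catr IH // red_catr.
Qed.

Lemma read_tree_path v : read v0 (tree_path Aconn v) = [::].
Proof.
elim/(dist_ind (Aconn := Aconn)): v => v IH; rewrite tree_pathE.
case E: (parent _ v) => [a|] //; have [ea _] := parent_edge E.
rewrite -cats1 read_cat IH //= (proj2 (tree_path_ok Aconn (tgt v a))) cats0.
by rewrite read1_linv // read1_tree // /tree_edge E eqxx.
Qed.

Definition gen_word (y : gens) : seq (T * bool) :=
  let: (v, x) := val y in
  tree_path Aconn v ++ (x, false) :: winv (tree_path Aconn (tgt v (x, false))).

Lemma gen_edge (y : gens) : @edge T A (val y).1 ((val y).2, false).
Proof. by have := valP y; rewrite /off_tree inE => /andP[]. Qed.

Lemma gen_word_accepts y : accepts v0 (gen_word y).
Proof.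
have := gen_edge y; case: y => -[v x] ? /= ev; rewrite /gen_word /=.
have [ok_v run_v] := tree_path_ok Aconn v.
have [ok_u run_u] := tree_path_ok Aconn (tgt v (x, false)).
have := ok_winv ok_u; have := run_winv ok_u; rewrite run_u => run_wu ok_wu.
by rewrite /accepts ok_cat run_cat ok_v run_v /= ev ok_wu run_wu eqxx.
Qed.

Lemma read_gen_word y : read v0 (gen_word y) = [:: (y, false)].
Proof.
case: y => -[v x] ev; rewrite /gen_word /=.
have [ok_v run_v] := tree_path_ok Aconn v.
have [ok_u run_u] := tree_path_ok Aconn (tgt v (x, false)).
have := read_winv ok_u; rewrite run_u read_tree_path => read_wu.
by rewrite read_cat read_tree_path run_v /= read_wu cats0 /read1 /pos_of /= insubT.
Qed.

(** Tree paths read as nothing, so reading is a left inverse of substituting the generators. Since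
    reading also respects free reduction, the generators are free. *)
Lemma read_wsubst (w : seq (gens * bool)) : read v0 (wsubst gen_word w) = w.
Proof.
elim: w => [|[y c] w IH] //; rewrite /wsubst /= read_cat -/(wsubst _ w).
have /andP[oky /eqP runy] := gen_word_accepts y.
case: c; last by rewrite runy IH read_gen_word.
have := read_winv oky; have := run_winv oky; rewrite runy => -> ->.
by rewrite IH read_gen_word.
Qed.

Variables (G : groupType) (b : T -> G) (H : set G).
Hypotheses (bfree : free_words b) (Hrange : forall g, H g -> exists w, fval b w = g).
Hypothesis rec : recognizes b v0 H.

Definition gen_val y := fval b (gen_word y).

Lemma fval_read1 v a : edge v a ->
  fval b (tree_path Aconn v ++ [:: a]) =
  fval gen_val (read1 v a) * fval b (tree_path Aconn (tgt v a)).
Proof.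
have pos u x : edge u (x, false) -> fval b (tree_path Aconn u ++ [:: (x, false)]) =
    fval gen_val (read1 u (x, false)) * fval b (tree_path Aconn (tgt u (x, false))).
  move=> eu; have [tu|ntu] := boolP (tree_edge Aconn u (x, false)).
    rewrite read1_tree // fval_nil mul1g.
    case/orP: tu => /eqP E; last by rewrite [in RHS]tree_pathE E linvK -cats1 tgtK.
    rewrite tree_pathE E -cats1 -catA !fval_cat !fval1.
    by rewrite (letter_val_linv b (x, false)) mulVg mulg1.
  rewrite /read1 /pos_of /= insubT /=; first by rewrite /off_tree inE /= eu.
  move=> ?; rewrite [in RHS]fval1 /letter_val /= /gen_val /gen_word SubK.
  by rewrite !fval_cat (fval_cons _ _ (winv _)) fval_winv -!mulgA mulVg mulg1 fval1.
case: a => x [] ea; last exact: pos.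
have := pos _ _ (edge_linv ea); rewrite -[(x, false)]/(linv (x, true)) tgtK // read1_linv //.
rewrite fval_winv !fval_cat fval1 letter_val_linv => E.
by rewrite -[fval b (tree_path _ v)](mulVKg (fval gen_val (read1 v (x, true)))) -E fval1
  -!mulgA mulVg mulg1.
Qed.

(** Telescoping: after each letter, return to [v0] along the tree and come back. For a loop at [v0]
    both tree paths are empty, so its value is a product of generators. *)
Lemma fval_read v w : ok v w ->
  fval b (tree_path Aconn v ++ w) =
  fval gen_val (read v w) * fval b (tree_path Aconn (run v w)).
Proof.
elim: w v => [|a w IH] v /=; first by rewrite cats0 fval_nil mul1g.
move=> /andP[ea okw]; rewrite -cat1s catA (fval_cat b) fval_read1 // (fval_cat gen_val).
by rewrite -!mulgA -IH // fval_cat.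
Qed.

Lemma gen_val_free_family : free_family gen_val H.
Proof.
have subE (w : seq (gens * bool)) : fval b (wsubst gen_word w) = fval gen_val w.
  by rewrite fval_wsubst.
have acc (w : seq (gens * bool)) : accepts v0 (wsubst gen_word w).
  exact: accepts_wsubst gen_word_accepts.
split=> [w1 w2 red1 red2|g].
  rewrite -!subE => /(free_words_red bfree) E.
  have readE (w : seq (gens * bool)) : reduced w -> w = red (read v0 (red (wsubst gen_word w))).
    by move=> rw; rewrite read_red ?read_wsubst ?red_id //; case/andP: (acc w).
  by rewrite (readE w1) // E -readE.
split=> [Hg|[w <-]]; last by rewrite -subE; apply: recognizes_accepts rec (acc w).
have [w Ew] := Hrange Hg.
have : accepts v0 (red w) by apply/rec; rewrite ?red_reduced // fval_red Ew.
case/andP=> okw /eqP runw; exists (read v0 (red w)).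
have := fval_read okw; rewrite runw tree_pathE parent_base /= fval_nil mulg1 => <-.
by rewrite fval_red.
Qed.

End NielsenSchreier.

Lemma automaton_free_family (T : finType) (A : graph T) (v0 : A) (G : groupType)
    (b : T -> G) (H : set G) :
  connected v0 -> free_words b -> (forall g, H g -> exists w, fval b w = g) ->
  recognizes b v0 H ->
  exists (I : finType) (c : I -> G),
    free_family c H /\ #|I| + #|A| = #|pos_edges A|.+1.
Proof.
move=> Aconn bfree Hrange rec; exists {vx | off_tree Aconn vx}.
exists (@gen_val _ _ _ Aconn _ b); split; last exact: card_off_tree.
exact: gen_val_free_family.
Qed.

(** * Core graphs of finitely generated subgroups *)

Section Core.
Variables (T : finType) (A : graph T) (v0 : A).
Implicit Types (v : A) (a : T * bool) (u w : seq (T * bool)).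

Definition core_edge v a := `[< exists u w,
  [/\ reduced (u ++ a :: w), accepts v0 (u ++ a :: w) & run v0 u = v] >].

(** The base is kept even if no edge survives, as happens for the trivial subgroup. *)
Definition core_vert v := (v == v0) || [exists a, core_edge v a].

Lemma core_edge_edge v a : core_edge v a -> edge v a.
Proof. by move=> /asboolP[u [w [_ /andP[+ _] <-]]]; rewrite ok_cat => /and3P[]. Qed.

Lemma core_edge_linv v a : core_edge v a -> core_edge (tgt v a) (linv a).
Proof.
move=> /asboolP[u [w [redw acc <-]]]; apply/asboolP.
exists (winv w), (winv u); rewrite -cat_rcons -winv_cons -winv_cat.
rewrite reduced_winv accepts_winv //; split=> //.
move: acc => /andP[]; rewrite ok_cat run_cat => /and3P[oku ea okw] /eqP Ew.
by have := run_winv okw; rewrite -[run (tgt _ a) w]/(run (run v0 u) (a :: w)) Ew.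
Qed.

Lemma core_edge_vert v a : core_edge v a -> core_vert v.
Proof. by move=> ea; apply/orP; right; apply/existsP; exists a. Qed.

Let B := {v | core_vert v}.

Fact core_base_subproof : core_vert v0.
Proof. by rewrite /core_vert eqxx. Qed.

Definition core_base : B := Sub v0 core_base_subproof.

Definition core_tgt (v : B) a : B := insubd core_base (tgt (val v) a).

Lemma val_core_tgt (v : B) a : core_edge (val v) a -> val (core_tgt v a) = tgt (val v) a.
Proof. by move=> ea; rewrite val_insubd (core_edge_vert (core_edge_linv ea)). Qed.

Fact core_graph_linv (v : B) a :
  core_edge (val v) a -> core_edge (val (core_tgt v a)) (linv a).
Proof. by move=> ea; rewrite val_core_tgt // core_edge_linv. Qed.

Fact core_graph_tgtK (v : B) a :
  core_edge (val v) a -> core_tgt (core_tgt v a) (linv a) = v.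
Proof.
move=> ea; apply: val_inj; rewrite val_core_tgt ?core_graph_linv // val_core_tgt //.
by rewrite tgtK // core_edge_edge.
Qed.

Definition core_graph : graph T := Graph core_graph_linv core_graph_tgtK.

Lemma core_ok (v : core_graph) w : ok v w -> ok (val v) w /\ val (run v w) = run (val v) w.
Proof.
elim: w v => [|a w IH] v //= /andP[ea /IH[]].
by rewrite val_core_tgt // => -> ->; rewrite core_edge_edge.
Qed.

(** Every letter of a reduced accepted word is a core edge, witnessed by the word itself cut at that
    letter. *)
Lemma core_prefix u w : reduced (u ++ w) -> accepts v0 (u ++ w) ->
  ok (core_base : core_graph) u /\ val (run (core_base : core_graph) u) = run v0 u.
Proof.
elim/last_ind: u w => [|u a IH] w; first by rewrite SubK.
rewrite cat_rcons => redw acc; have [oku runu] := IH _ redw acc.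
have ea : core_edge (run v0 u) a by apply/asboolP; exists u, w.
by rewrite ok_rcons oku /edge /= !run_rcons runu ea val_core_tgt runu.
Qed.

Lemma core_accepts w : reduced w ->
  accepts (core_base : core_graph) w = accepts v0 w.
Proof.
move=> redw; apply/idP/idP => [/andP[okw /eqP Ew]|acc].
  by have [] := core_ok okw; rewrite /accepts Ew SubK => -> <-; rewrite eqxx.
have [] := @core_prefix w [::]; rewrite ?cats0 // /accepts => -> Ew /=.
by apply/eqP/val_inj; rewrite Ew SubK; case/andP: acc => _ /eqP.
Qed.

Lemma core_connected : connected (core_base : core_graph).
Proof.
move=> v; have := valP v => /orP[/eqP Ev|/existsP[a /asboolP[u [w [redw acc Ev]]]]].
  by exists [::] => //; apply: val_inj; rewrite Ev SubK.
have [oku runu] := core_prefix redw acc.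
by exists u => //; apply: val_inj; rewrite runu.
Qed.

Lemma core_trim : trim (core_base : core_graph).
Proof.
move=> v a /asboolP[u [w [redw acc Ev]]]; exists u, w.
have [oku runu] := core_prefix redw acc.
by split; rewrite ?core_accepts //; apply: val_inj; rewrite runu.
Qed.

End Core.

Section Product.
Variables (T : eqType) (A B : graph T).

Definition prod_edge (p : A * B) a := edge p.1 a && edge p.2 a.

Definition prod_tgt (p : A * B) a := (tgt p.1 a, tgt p.2 a).

Fact prod_graph_linv (p : A * B) a : prod_edge p a -> prod_edge (prod_tgt p a) (linv a).
Proof. by case/andP=> ea eb; rewrite /prod_edge !edge_linv. Qed.

Fact prod_graph_tgtK (p : A * B) a : prod_edge p a -> prod_tgt (prod_tgt p a) (linv a) = p.
Proof. by case: p => p q /andP[/= ea eb]; rewrite /prod_tgt /= !tgtK. Qed.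

Definition prod_graph : graph T := Graph prod_graph_linv prod_graph_tgtK.

Lemma prod_ok (p : prod_graph) w : ok p w = ok p.1 w && ok p.2 w.
Proof. by elim: w p => [|a w IH] p //=; rewrite IH /edge /= andbACA. Qed.

Lemma prod_run (p : prod_graph) w : run p w = (run p.1 w, run p.2 w).
Proof. by elim: w p => [|a w IH] [p q] //=; rewrite IH. Qed.

Lemma prod_accepts v u w :
  accepts ((v, u) : prod_graph) w = accepts v w && accepts u w.
Proof. by rewrite /accepts prod_ok prod_run andbACA. Qed.

End Product.

(** * Finite pieces of Schreier graphs *)

Section Subgroups.
Local Open Scope group_scope.
Variables (G : groupType).
Implicit Types (H K A : set G).

Lemma subgroupP H : subgroup H <-> H 1 /\ forall x y, H x -> H y -> H (x / y).
Proof.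
split=> -[H1 HB]; split; first exact/set_mem.
- by move=> x y Hx Hy; apply/set_mem/HB; apply: mem_set.
- exact/mem_set.
- by move=> x y /set_mem Hx /set_mem Hy; apply/mem_set/HB.
Qed.

Section Closure.
Variables (H : set G) (sH : subgroup H).

Lemma subgroup1 : H 1. Proof. by case/subgroupP: sH. Qed.

Lemma subgroupV x : H x -> H x^-1.
Proof.
by case/subgroupP: sH => H1 HB Hx; rewrite -[_^-1]mul1g; apply: HB.
Qed.

Lemma subgroupM x y : H x -> H y -> H (x * y).
Proof.
move=> Hx /subgroupV Hy; rewrite -[y]invgK.
by case/subgroupP: sH => _; apply.
Qed.

End Closure.

Lemma sub_gen A : (A `<=` gen A)%classic.
Proof. by move=> g Ag K [_]; apply. Qed.

Lemma gen_min A K : subgroup K -> (A `<=` K)%classic -> (gen A `<=` K)%classic.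
Proof. by move=> sK AK g; apply. Qed.

Lemma subgroup_gen A : subgroup (gen A).
Proof.
apply/subgroupP; split=> [K [sK _]|x y Ax Ay K KP]; first exact: subgroup1.
apply: subgroupM; first by case: KP.
  exact: Ax.
by apply: subgroupV; [case: KP | exact: Ay].
Qed.

Lemma fin_gen_join H K : fin_gen H -> fin_gen K -> fin_gen (join H K).
Proof.
move=> [A Afin <-] [B Bfin <-]; exists (A `|` B)%classic; first by rewrite finite_setU.
apply/seteqP; split; apply: gen_min; try exact: subgroup_gen.
  by move=> g [Ag|Bg]; apply: sub_gen; [left|right]; exact: sub_gen.
move=> g [Ag|Bg]; [apply: (gen_min _ _ Ag)|apply: (gen_min _ _ Bg)];
  try exact: subgroup_gen; move=> x Xx; apply: sub_gen; by [left|right].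
Qed.

End Subgroups.

Section Schreier.
Local Open Scope group_scope.
Local Open Scope classical_set_scope.
Variables (G : groupType) (T : eqType) (b : T -> G).
Implicit Types (C : set G) (a : T * bool) (w : seq (T * bool)).

(** This is [C g]; the translates of a subgroup are its right cosets, the vertices of its Schreier
    graph. *)
Definition translate C g : set G := [set x | C (x / g)].

Lemma translateM C g g' : translate (translate C g) g' = translate C (g * g').
Proof. by apply/seteqP; split=> x; rewrite /translate /= invgM mulgA. Qed.

Lemma translate1 C : translate C 1 = C.
Proof. by apply/seteqP; split=> x; rewrite /translate /= invg1 mulg1. Qed.

Definition act C a := translate C (letter_val (b a.1, a.2)).

Lemma actK C a : act (act C a) (linv a) = C.
Proof. by rewrite /act translateM letter_val_linv mulgV translate1. Qed.

Variable S : seq (set G).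

(** Only the part of the Schreier graph on the finite list [S] is kept; an edge exists when the
    target coset is also in [S]. *)
Definition schreier_tgt (v : seq_sub S) a : seq_sub S := insubd v (act (val v) a).

Lemma val_schreier_tgt (v : seq_sub S) a :
  act (val v) a \in S -> val (schreier_tgt v a) = act (val v) a.
Proof. by move=> aS; rewrite val_insubd aS. Qed.

Fact schreier_linv (v : seq_sub S) a :
  act (val v) a \in S -> act (val (schreier_tgt v a)) (linv a) \in S.
Proof. by move=> aS; rewrite val_schreier_tgt // actK; exact: valP. Qed.

Fact schreier_tgtK (v : seq_sub S) a :
  act (val v) a \in S -> schreier_tgt (schreier_tgt v a) (linv a) = v.
Proof.
move=> aS; apply: val_inj; rewrite val_schreier_tgt ?schreier_linv //.
by rewrite val_schreier_tgt // actK.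
Qed.

Definition schreier_graph : graph T := Graph schreier_linv schreier_tgtK.

Lemma schreier_run (v : schreier_graph) w :
  ok v w -> val (run v w) = translate (val v) (fval b w).
Proof.
elim: w v => [|a w IH] v /=; first by rewrite fval_nil translate1.
move=> /andP[ea /IH ->]; rewrite val_schreier_tgt //.
by rewrite fval_cons -translateM.
Qed.

Lemma schreier_ok (v : schreier_graph) w :
  (forall n, translate (val v) (fval b (take n w)) \in S) -> ok v w.
Proof.
elim: w v => [|a w IH] v //= HS.
have ea : act (val v) a \in S by have := HS 1%N; rewrite /= take0 fval1.
rewrite /edge /= ea; apply: IH => n; rewrite val_schreier_tgt // translateM -fval_cons.
exact: (HS n.+1).
Qed.

End Schreier.

(** The cosets met while spelling the generators suffice. The values of accepted words form a
    subgroup containing the generators, hence [H]; conversely a loop at the coset [H] spells an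
    element of [H]. *)
Lemma fin_gen_automaton (G : groupType) (T : finType) (b : T -> G) (H : set G) :
  subgroup H -> fin_gen H -> free_words b ->
  (forall g, H g -> exists w, fval b w = g) ->
  exists (A : graph T) (v0 : A), recognizes b v0 H.
Proof.
move=> sH [A /finite_seqP[s ->] genH] bfree Hrange.
have /boolp.choice[wd wdE] : forall g, exists w, H g -> fval b w = g.
  move=> g; have [/Hrange[w Ew]|nHg] := pselect (H g); first by exists w.
  by exists [::].
have Hs g : g \in s -> H g by move=> gs; rewrite -genH; exact: sub_gen.
pose prefixes w := [seq translate H (fval b (take n w)) | n <- iota 0 (size w).+1].
pose S := H :: flatten [seq prefixes (wd g) | g <- s].
pose v0 : schreier_graph b S := Sub H (mem_head _ _).
exists (schreier_graph b S), v0.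
have acc_s g : g \in s -> accepts v0 (wd g).
  move=> gs; have okg : ok v0 (wd g).
    apply: schreier_ok => n; rewrite SubK inE; apply/orP; right.
    apply/flattenP; exists (prefixes (wd g)); first exact: map_f.
    have [nlt|nge] := leqP n (size (wd g)).
      by apply/mapP; exists n; rewrite ?mem_iota.
    apply/mapP; exists (size (wd g)); first by rewrite mem_iota ltnSn.
    by rewrite take_size take_oversize // ltnW.
  rewrite /accepts okg /=; apply/eqP/val_inj; rewrite schreier_run // SubK wdE; last exact: Hs.
  apply/seteqP; split=> x; rewrite /translate /= => Hx; have Hg := Hs _ gs.
    by rewrite -[x](mulgVK g); apply: subgroupM.
  by apply: subgroupM => //; apply: subgroupV.
pose L : set G := [set g | exists2 w, accepts v0 w & fval b w = g]%classic.
have HL : (H `<=` L)%classic.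
  rewrite -genH; apply: gen_min; last first.
    by move=> x /= xs; exists (wd x); [exact: acc_s | exact/wdE/Hs].
  apply/subgroupP; split; first by exists [::]; rewrite ?fval_nil // /accepts /=.
  move=> _ _ [u accu <-] [w accw <-]; exists (u ++ winv w).
    by apply: accepts_cat => //; apply: accepts_winv.
  by rewrite fval_cat fval_winv.
move=> w redw; split=> [/HL[w' acc' E]|/andP[okw /eqP runw]].
  by rewrite -(red_id redw) -(free_words_red bfree E); apply: accepts_red.
have := schreier_run okw; rewrite runw SubK => E.
by rewrite E /translate /= mulgV; exact: subgroup1.
Qed.

(** * Degrees and the number of trivalent vertices *)

Section Degrees.
Variables (T : finType) (A : graph T).
Implicit Types (v : A) (a c : T * bool).

Definition rk a : nat := enum_rank a.

Lemma rk_inj : injective rk.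
Proof. by move=> a c /ord_inj/enum_rank_inj. Qed.

Definition lt_edge v a := [exists c, edge v c && (rk c < rk a)].
Definition le_edge v a := [exists c, edge v c && (rk c <= rk a)].
Definition gt_edge v a := [exists c, edge v c && (rk a < rk c)].
Definition ge_edge v a := [exists c, edge v c && (rk a <= rk c)].

(** Edges that are neither first nor last at [v] in the order of letters. They become the trivalent
    vertices of the blow-up ([ends_full]), so a vertex of degree d yields d - 2 of them. *)
Definition mid v a := [&& edge v a, lt_edge v a & gt_edge v a].

Definition mids := [set va : A * (T * bool) | mid va.1 va.2].

Definition deg2 v := exists a c, [/\ a != c, edge v a & edge v c].

Lemma card_edges : #|[set va : A * (T * bool) | edge va.1 va.2]| = 2 * #|pos_edges A|.
Proof.
rewrite -(cardsID [set va | va.2.2]) addnC mul2n -addnn; congr (_ + _).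
  rewrite -(card_imset _ (_ : injective (fun vx : A * T => (vx.1, (vx.2, false))))).
    apply: eq_card => -[v [x c]]; rewrite !inE /=; apply/andP/imsetP.
      by case: c => -[] // _ ea; exists (v, x); rewrite ?inE.
    by case=> -[u y]; rewrite inE /= => eu [-> -> ->].
  by move=> [v x] [u y] [-> ->].
rewrite -(card_in_imset (_ : {in pos_edges A &,
  injective (fun vx : A * T => (tgt vx.1 (vx.2, false), (vx.2, true)))})).
  apply: eq_card => -[v [x c]]; rewrite !inE /=; apply/andP/imsetP.
    case: c => -[ea] // _; exists (tgt v (x, true), x).
      by rewrite inE /= (edge_linv ea).
    by rewrite /= -[(x, false)]/(linv (x, true)) tgtK.
  by case=> -[u y]; rewrite inE /= => eu [-> -> ->]; rewrite (edge_linv eu).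
move=> [v x] [u y]; rewrite !inE /= => ev eu [E xy].
by rewrite -(tgtK ev) -(tgtK eu) E xy.
Qed.

Lemma card_mid v : deg2 v -> #|[set a | edge v a]| = #|[set a | mid v a]| + 2.
Proof.
move=> [a1 [a2 [a12 e1 e2]]].
case: (arg_minnP rk e1) => amin emin min_le.
case: (arg_maxnP rk e1) => amax emax amax_ge.
have max_ge c : edge v c -> rk c <= rk amax by exact: amax_ge.
have nmM : amin != amax.
  apply: contra_neq a12 => E; apply: rk_inj; apply/eqP.
  have le x y : edge v x -> edge v y -> rk x <= rk y.
    by move=> ex ey; apply: leq_trans (max_ge _ ex) _; rewrite -E; exact: min_le.
  by rewrite eqn_leq; apply/andP; split; apply: le.
rewrite (cardsD1 amin) (cardsD1 amax) !inE emin emax eq_sym nmM add1n add1n addn2.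
congr _.+2; apply: eq_card => a; rewrite !inE /mid.
have neq_lt x y : x != y -> rk x <= rk y -> rk x < rk y.
  by move=> xy le; rewrite ltn_neqAle le andbT (inj_eq rk_inj).
apply/and3P/and3P => [[aM am ea]|[ea /existsP[c /andP[ec ca]] /existsP[d /andP[ed ad]]]].
  split=> //; apply/existsP; [exists amin|exists amax].
    by rewrite emin neq_lt ?min_le // eq_sym.
  by rewrite emax neq_lt ?max_ge.
split=> //.
  by apply: contraTneq ad => ->; rewrite -leqNgt max_ge.
by apply: contraTneq ca => ->; rewrite -leqNgt min_le.
Qed.

Lemma card_fst (U V : finType) (P : U -> V -> bool) :
  #|[set uv : U * V | P uv.1 uv.2]| = \sum_u #|[set v | P u v]|.
Proof.
rewrite -sum1_card (eq_bigl (fun uv => P uv.1 uv.2)); last by move=> uv; rewrite inE.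
rewrite -(pair_big_dep xpredT P (fun _ _ => 1)) /=.
by apply: eq_bigr => u _; rewrite -sum1_card; apply: eq_bigl => v; rewrite inE.
Qed.

(** Degree minus 2, summed over the vertices, is twice the difference of edges and vertices; for a
    connected graph this is 2 (rank - 1). *)
Lemma card_mids : (forall v, deg2 v) -> #|mids| + 2 * #|A| = 2 * #|pos_edges A|.
Proof.
move=> d2; rewrite -card_edges /mids (card_fst (fun v a => mid v a)).
rewrite (card_fst (fun v a => edge v a)) (eq_bigr _ (fun v _ => card_mid (d2 v))).
by rewrite big_split /= sum_nat_const mulnC.
Qed.

(** A reduced loop through another vertex enters and leaves it by different edges. At [v0] the first
    letter and the inverse of the last one differ, since the loop is cyclically reduced. *)
Lemma core_deg2 (v0 : A) a w : trim v0 -> connected v0 ->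
  accepts v0 (a :: w) -> last a w != linv a -> forall v, deg2 v.
Proof.
move=> Atrim Aconn acc aw v.
have [->|vv0] := eqVneq v v0.
  exists a, (linv (last a w)); split.
  - by apply: contra_neq aw => E; rewrite -[LHS]linvK -E.
  - by case/andP: acc => /andP[].
  - have := accepts_winv acc; rewrite lastI /winv map_rcons rev_rcons.
    by case/andP=> /andP[].
have [w' okw' runw'] := Aconn v.
have [c ec] : exists c, edge v c.
  case/lastP: w' okw' runw' => [|w' c]; first by move=> _ E; rewrite -E eqxx in vv0.
  by rewrite ok_rcons run_rcons => /andP[_ ec] <-; exists (linv c); apply: edge_linv.
have [u [u' [redu /andP[oku _] runu]]] := Atrim _ _ ec.
case/lastP: u redu oku runu => [|u d]; first by move=> _ _ E; rewrite -E eqxx in vv0.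
rewrite cat_rcons ok_cat run_rcons /= => redu /and3P[_ ed _] Ev.
exists c, (linv d); split=> //; last by rewrite -Ev edge_linv.
by have [_] := reduced_cat redu; rewrite reduced_cons => /andP[].
Qed.

End Degrees.
Arguments rk_inj {T}.

(** * Cochains of the coequalizer *)

(* For a linear map [f] with kernel [K], and [d] the subtraction of the source. *)
Lemma card_fibers (U V : finType) (f : U -> V) (D K : {set U}) (B : {set V})
    (d : U -> U -> U) :
  {in D, forall x, f x \in B} ->
  {in D &, forall x y, f x = f y -> d x y \in K} ->
  (forall y, injective (d^~ y)) -> #|D| <= #|K| * #|B|.
Proof.
move=> fB dK dI; rewrite -sum1_card (partition_big f (mem B)) //=.
rewrite mulnC -sum_nat_const; apply: leq_sum => v _; rewrite sum1_card.
have [y /andP[yD /eqP yv]|none] := pickP (fun y => (y \in D) && (f y == v)); last first.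
  by rewrite eq_card0 // => x; rewrite unfold_in none.
rewrite -(card_imset _ (dI y)); apply: subset_leq_card; apply/fintype.subsetP => _ /imsetP[x + ->].
by rewrite unfold_in => /andP[xD /eqP xv]; apply: dK; rewrite // xv.
Qed.

Definition two (p : pred 'I_3) := exists i j, [/\ i != j, p i & p j].

(** Only one index remains: its end is either absent, or all three are present and the sum
    decides. *)
Lemma two_zero (p : pred 'I_3) (a : 'I_3 -> 'F_2) i j :
  i != j -> a i = 0%R -> a j = 0%R -> (forall k, ~~ p k -> a k = 0%R) ->
  p i -> p j -> ((forall k, p k) -> (\sum_k a k)%R = 0%R) -> forall k, a k = 0%R.
Proof.
move=> ij ai aj supp pi pj psum k.
have [pk|/supp //] := boolP (p k).
have [-> //|ki] := eqVneq k i; have [-> //|kj] := eqVneq k j.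
have cover l : l \in [:: i; j; k].
  have /subset_cardP: #|[:: i; j; k]| = #|'I_3|.
    by rewrite card_ord; apply/card_uniqP; rewrite /= !inE negb_or ij eq_sym ki eq_sym kj.
  by move/(_ (subset_predT _)) ->.
rewrite -psum; last by move=> l; have := cover l; rewrite !inE => /or3P[] /eqP ->.
rewrite (bigD1 k) //= big1 ?addr0 // => l lk.
by have := cover l; rewrite !inE (negbTE lk) orbF => /orP[] /eqP ->.
Qed.

(* [N] and [W] are the vertices of two graphs with at most three ends at each vertex, [s]
   and [t] are morphisms from the second graph to the first; vertices without ends are
   absent.  The three sets of functions below are the cochains of the coequalizer on the
   ends and on the vertices, and the functions on the classes of trivalent vertices
   generated by [s w ~ t w] for trivalent [w] only. *)
Section TrivalentCoequalizer.
Variables (N W : finType) (s t : W -> N) (P : N -> pred 'I_3) (Q : W -> pred 'I_3).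
Hypothesis QP : forall w i, Q w i -> P (s w) i && P (t w) i.
Hypothesis twoP : forall n i, P n i -> two (P n).
Hypothesis twoQ : forall w i, Q w i -> two (Q w).
Local Open Scope ring_scope.
Implicit Types (n : N) (w : W) (i : 'I_3).

Definition pres n := [exists i, P n i].
Definition link w := [exists i, Q w i].
Definition full n := [forall i, P n i].
Definition flink w := [forall i, Q w i].

Definition end_funs := [set a : {ffun N * 'I_3 -> 'F_2} |
  [forall n, forall i, P n i || (a (n, i) == 0)] &&
  [forall w, forall i, Q w i ==> (a (s w, i) == a (t w, i))]].

Definition vert_funs := [set f : {ffun N -> 'F_2} |
  [forall n, pres n || (f n == 0)] && [forall w, link w ==> (f (s w) == f (t w))]].

Definition full_funs := [set m : {ffun N -> 'F_2} |
  [forall n, full n || (m n == 0)] && [forall w, flink w ==> (m (s w) == m (t w))]].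

Lemma end_funsP (a : {ffun N * 'I_3 -> 'F_2}) : reflect ((forall n i, ~~ P n i -> a (n, i) = 0) /\
  (forall w i, Q w i -> a (s w, i) = a (t w, i))) (a \in end_funs).
Proof.
rewrite inE; apply: (iffP andP) => -[H1 H2]; split.
- by move=> n i /negbTE nP; move/forallP/(_ n)/forallP/(_ i): H1; rewrite nP => /eqP.
- by move=> w i Qi; move/forallP/(_ w)/forallP/(_ i)/implyP/(_ Qi)/eqP: H2.
- by apply/'forall_forallP => n i; case: (boolP (P n i)) => // /H1 ->; rewrite eqxx.
- by apply/'forall_forallP => w i; apply/implyP => /H2 ->.
Qed.

Lemma vert_funsP (f : {ffun N -> 'F_2}) : reflect ((forall n, ~~ pres n -> f n = 0) /\
  (forall w, link w -> f (s w) = f (t w))) (f \in vert_funs).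
Proof.
rewrite inE; apply: (iffP andP) => -[H1 H2]; split.
- by move=> n /negbTE nP; move/forallP/(_ n): H1; rewrite nP => /eqP.
- by move=> w Qw; move/forallP/(_ w)/implyP/(_ Qw)/eqP: H2.
- by apply/forallP => n; case: (boolP (pres n)) => // /H1 ->; rewrite eqxx.
- by apply/forallP => w; apply/implyP => /H2 ->.
Qed.

Lemma full_funsP (f : {ffun N -> 'F_2}) : reflect ((forall n, ~~ full n -> f n = 0) /\
  (forall w, flink w -> f (s w) = f (t w))) (f \in full_funs).
Proof.
rewrite inE; apply: (iffP andP) => -[H1 H2]; split.
- by move=> n /negbTE nP; move/forallP/(_ n): H1; rewrite nP => /eqP.
- by move=> w Qw; move/forallP/(_ w)/implyP/(_ Qw)/eqP: H2.
- by apply/forallP => n; case: (boolP (full n)) => // /H1 ->; rewrite eqxx.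
- by apply/forallP => w; apply/implyP => /H2 ->.
Qed.

(** Trivalent links transfer all three values and so preserve this sum; a bivalent link need not,
    hence the use of [flink] in [full_funs]. *)
Definition end_sum (a : {ffun N * 'I_3 -> 'F_2}) : {ffun N -> 'F_2} :=
  [ffun n => if full n then \sum_i a (n, i) else 0].

Lemma flink_full w : flink w -> full (s w) && full (t w).
Proof.
by move=> /forallP Qw; apply/andP; split; apply/forallP => i; case/andP: (QP (Qw i)).
Qed.

Lemma end_sum_full a : a \in end_funs -> end_sum a \in full_funs.
Proof.
move=> /end_funsP[_ aQ]; apply/full_funsP; split=> [n /negbTE nf|w fw].
  by rewrite ffunE nf.
have /andP[fs ft] := flink_full fw; rewrite !ffunE fs ft.
by apply: eq_bigr => i _; apply: aQ; exact: (forallP fw).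
Qed.

(* An element of the kernel is determined, on a component, by two of its values at a
   single vertex: along each link at least two values are transferred, and the third one
   follows from the sum. *)
Definition end_kernel := [set a in end_funs | [forall n, end_sum a n == 0]].

Lemma card_end_funs : (#|end_funs| <= #|end_kernel| * #|full_funs|)%N.
Proof.
apply: (card_fibers (f := end_sum) (d := fun a c => [ffun x => a x - c x])).
- exact: end_sum_full.
- move=> a c aD cD E.
  have /end_funsP[a0 aQ] := aD; have /end_funsP[c0 cQ] := cD.
  rewrite inE; apply/andP; split.
    apply/end_funsP; split=> [n i nP|w i Qi]; rewrite !ffunE.
      by rewrite a0 // c0 // subr0.
    by rewrite aQ // cQ.
  apply/forallP => n; move/ffunP/(_ n): E; rewrite !ffunE; case: ifP => // _ E.
  by under eq_bigr => i _ do rewrite ffunE; rewrite sumrB E subrr.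
- move=> c a a' /ffunP E; apply/ffunP => x.
  by have := E x; rewrite !ffunE => /addIr.
Qed.

Definition joined : rel N := fun n n' =>
  [exists w, link w && (((s w == n) && (t w == n')) || ((s w == n') && (t w == n)))].

Lemma joined_sym : symmetric joined.
Proof. by move=> n n'; apply: eq_existsb => w; rewrite orbC. Qed.

Lemma joined_pres n n' : joined n n' -> pres n && pres n'.
Proof.
have presw w i : Q w i -> pres (s w) && pres (t w).
  by move=> /QP /andP[p1 p2]; apply/andP; split; apply/existsP; exists i.
move=> /existsP[w /andP[/existsP[i /presw]]].
by move=> + /orP[] /andP[/eqP <- /eqP <-]; rewrite andbC // => /andP[-> ->].
Qed.

Lemma connect_transfer (Z : N -> Prop) n n' :
  (forall n1 n2, joined n1 n2 -> Z n1 -> Z n2) -> connect joined n n' -> Z n -> Z n'.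
Proof.
move=> step /connectP[p + ->]; elim: p n => [|n1 p IH] n //= /andP[j pp] Zn.
by apply: IH => //; exact: step j Zn.
Qed.

Lemma connect_joined_sym : connect_sym joined.
Proof. exact: sym_connect_sym joined_sym. Qed.

Definition first_end n := odflt ord0 [pick i | P n i].
Definition second_end n := odflt ord0 [pick i | P n i && (i != first_end n)].

Lemma first_second_end n : pres n ->
  [/\ P n (first_end n), P n (second_end n) & second_end n != first_end n].
Proof.
move=> /existsP[i0 /twoP[i [j [ij Pi Pj]]]].
have P1 : P n (first_end n).
  by rewrite /first_end; case: pickP => [//|/(_ i)]; rewrite Pi.
suff /andP[P2 neq] : P n (second_end n) && (second_end n != first_end n) by split.
rewrite /second_end; case: pickP => [//|none] /=.
have := none i; rewrite Pi => /negbFE /eqP E1; have := none j; rewrite Pj => /negbFE /eqP E2.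
by rewrite E1 E2 eqxx in ij.
Qed.

(** One value is read at the representative of the class and copied to the whole class. Doing so for
    two distinct ends stores a kernel element as two vertex functions. *)
Definition spread (a : {ffun N * 'I_3 -> 'F_2}) (e : N -> 'I_3) : {ffun N -> 'F_2} :=
  [ffun n => if pres n then a (fingraph.root joined n, e (fingraph.root joined n)) else 0].

Lemma spread_vert a e : spread a e \in vert_funs.
Proof.
apply/vert_funsP; split=> [n /negbTE np|w lw]; rewrite !ffunE ?np //.
have jw : joined (s w) (t w) by apply/existsP; exists w; rewrite lw !eqxx.
have /andP[-> ->] := joined_pres jw.
by have /(fingraph.rootP connect_joined_sym) -> := connect1 jw.
Qed.

Lemma card_end_kernel : (#|end_kernel| <= #|vert_funs| ^ 2)%N.
Proof.
pose f a := (spread a first_end, spread a second_end).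
have fI : {in end_kernel &, injective f}.
  move=> a c; rewrite inE => /andP[/end_funsP[a0 aQ] /forallP aS].
  rewrite inE => /andP[/end_funsP[c0 cQ] /forallP cS] [/ffunP E1 /ffunP E2].
  pose z n i := a (n, i) - c (n, i).
  have z0 n i : ~~ P n i -> z n i = 0 by move=> nP; rewrite /z a0 // c0 // subrr.
  have zS n : (forall i, P n i) -> \sum_i z n i = 0.
    move=> /forallP fn; have := aS n; have := cS n; rewrite !ffunE /full fn.
    by rewrite /z sumrB => /eqP -> /eqP ->; rewrite subrr.
  have zQ w i : Q w i -> z (s w) i = z (t w) i by move=> Qi; rewrite /z aQ // cQ.
  pose Z n := forall i, z n i = 0.
  have ZQ w i n : Q w i -> (n = s w \/ n = t w) -> (forall i, Q w i -> z n i = 0) -> Z n.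
    move=> /twoQ[j [k [jk Qj Qk]]] nw zn; apply: (two_zero jk (zn _ Qj) (zn _ Qk) (z0 n)).
    - by case: nw => ->; case/andP: (QP Qj).
    - by case: nw => ->; case/andP: (QP Qk).
    - exact: zS.
  have step n n' : joined n n' -> Z n -> Z n'.
    move=> /existsP[w /andP[/existsP[i Qi] /orP[]]] /andP[/eqP <- /eqP <-] Zn.
      by apply: (ZQ w i) => //; [right | move=> k Qk; rewrite -zQ].
    by apply: (ZQ w i) => //; [left | move=> k Qk; rewrite zQ].
  have Zn n : pres n -> Z n.
    move=> pn; have cn := connect_root joined n.
    have pr : pres (fingraph.root joined n).
      by apply: (connect_transfer (Z := pres) _ cn pn) => n1 n2 /joined_pres/andP[].
    have [P1 P2 neq] := first_second_end pr.
    rewrite connect_joined_sym in cn; apply: (connect_transfer step cn).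
    have := E2 n; have := E1 n; rewrite !ffunE pn => e1 e2.
    apply: (two_zero neq _ _ (z0 _) P2 P1 (@zS _)); rewrite /z ?e1 ?e2 ?subrr //.
  apply/ffunP => -[n i]; have [pn|npn] := boolP (pres n).
    by apply/eqP; rewrite -subr_eq0; apply/eqP/Zn.
  by rewrite a0 ?c0 //; apply: contra npn => Pi; apply/existsP; exists i.
rewrite -(card_in_imset fI) expnS expn1 -cardsX; apply: subset_leq_card; apply/fintype.subsetP.
by move=> _ /imsetP[a _ ->]; rewrite finset.in_setX !spread_vert.
Qed.

(** In exponents: twice the edges of the coequalizer is at most twice its vertices plus the number
    of trivalent classes. *)
Lemma card_end_funs_le : (#|end_funs| <= #|vert_funs| ^ 2 * #|full_funs|)%N.
Proof. by apply: leq_trans card_end_funs _; rewrite leq_mul2r card_end_kernel orbT. Qed.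

End TrivalentCoequalizer.

(* Every vertex [v] is replaced by a path, with vertices [(v, a)] for the letters [a]
   between the first and the last edge at [v]; the ends at [(v, a)] are the edge [a] at
   [v], if any, and the segments of the path towards smaller and larger letters. *)
Section BlowUp.
Variables (T : finType).
Implicit Types (a c : T * bool) (i : 'I_3).

Definition next a := nth a (enum {: T * bool}) (rk a).+1.
Definition prev a := nth a (enum {: T * bool}) (rk a).-1.

Lemma rk_nth a m : m < #|{: T * bool}| -> rk (nth a (enum {: T * bool}) m) = m.
Proof.
move=> mlt; rewrite /rk -[m in nth _ _ m]/(nat_of_ord (Ordinal mlt)).
by rewrite -enum_val_nth enum_valK.
Qed.

Lemma rk_next a c : rk a < rk c -> rk (next a) = (rk a).+1.
Proof. by move=> ac; rewrite rk_nth // (leq_ltn_trans ac) // ltn_ord. Qed.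

Lemma rk_prev a : rk (prev a) = (rk a).-1.
Proof. by rewrite rk_nth // (leq_ltn_trans (leq_pred _)) // ltn_ord. Qed.

Lemma nextK a c : rk a < rk c -> prev (next a) = a.
Proof. by move=> ac; apply: rk_inj; rewrite rk_prev (rk_next ac). Qed.

Lemma prevK a c : rk c < rk a -> next (prev a) = a.
Proof.
move=> ca; apply: rk_inj; have a0 : 0 < rk a by apply: leq_ltn_trans ca.
by rewrite (@rk_next _ a) rk_prev prednK.
Qed.

Variable A : graph T.
Implicit Types (v : A) (n : A * (T * bool)).

Definition ends n : pred 'I_3 := fun i =>
  match val i with
  | 0 => edge n.1 n.2
  | 1 => lt_edge n.1 n.2 && ge_edge n.1 n.2
  | _ => le_edge n.1 n.2 && gt_edge n.1 n.2
  end.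

Definition end0 : 'I_3 := ord0.
Definition end1 : 'I_3 := inord 1.
Definition end2 : 'I_3 := inord 2.

Lemma end_cases i : [\/ i = end0, i = end1 | i = end2].
Proof.
case: i => [[|[|[|//]]]] lti; [constructor 1|constructor 2|constructor 3];
  by apply: val_inj; rewrite /= ?inordK.
Qed.

Lemma ends0 n : ends n end0 = edge n.1 n.2. Proof. by []. Qed.
Lemma ends1 n : ends n end1 = lt_edge n.1 n.2 && ge_edge n.1 n.2.
Proof. by rewrite /ends /= inordK. Qed.
Lemma ends2 n : ends n end2 = le_edge n.1 n.2 && gt_edge n.1 n.2.
Proof. by rewrite /ends /= inordK. Qed.

Lemma ends_neq : [/\ end0 != end1, end0 != end2 & end1 != end2].
Proof. by split; rewrite -val_eqE /= ?inordK. Qed.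

Lemma lt_le_edge v a : lt_edge v a -> le_edge v a.
Proof. by case/existsP=> c /andP[ec /ltnW ca]; apply/existsP; exists c; rewrite ec. Qed.

Lemma gt_ge_edge v a : gt_edge v a -> ge_edge v a.
Proof. by case/existsP=> c /andP[ec /ltnW ca]; apply/existsP; exists c; rewrite ec. Qed.

Lemma edge_le_edge v a : edge v a -> le_edge v a.
Proof. by move=> ea; apply/existsP; exists a; rewrite ea leqnn. Qed.

Lemma edge_ge_edge v a : edge v a -> ge_edge v a.
Proof. by move=> ea; apply/existsP; exists a; rewrite ea leqnn. Qed.

Lemma le_edgeE v a : le_edge v a = edge v a || lt_edge v a.
Proof.
apply/idP/orP => [/existsP[c /andP[ec]]|[/edge_le_edge//|/lt_le_edge//]].
rewrite leq_eqVlt => /orP[/eqP/rk_inj <-|ca]; first by left.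
by right; apply/existsP; exists c; rewrite ec.
Qed.

Lemma ge_edgeE v a : ge_edge v a = edge v a || gt_edge v a.
Proof.
apply/idP/orP => [/existsP[c /andP[ec]]|[/edge_ge_edge//|/gt_ge_edge//]].
rewrite leq_eqVlt => /orP[/eqP/rk_inj ->|ca]; first by left.
by right; apply/existsP; exists c; rewrite ec.
Qed.

Lemma ends_pres n i : ends n i -> le_edge n.1 n.2 && ge_edge n.1 n.2.
Proof.
case: (end_cases i) => ->; rewrite ?ends0 ?ends1 ?ends2.
- by move=> e0; rewrite edge_le_edge // edge_ge_edge.
- by case/andP=> /lt_le_edge -> ->.
- by case/andP=> -> /gt_ge_edge ->.
Qed.

Lemma ends_two n i : deg2 n.1 -> ends n i -> two (ends n).
Proof.
move=> [a1 [a2 [a12 e1 e2]]] /ends_pres /andP[le ge].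
have [n01 n02 n12] := ends_neq.
have [e|ne] := boolP (edge n.1 n.2); last first.
  exists end1, end2; rewrite ends1 ends2 le ge n12.
  by move: le ge; rewrite le_edgeE ge_edgeE (negbTE ne) /= => -> ->.
have [c ec cn] : exists2 c, edge n.1 c & c != n.2.
  have [E|] := eqVneq a1 n.2; last by exists a1.
  by exists a2 => //; rewrite -E eq_sym.
move: cn; rewrite -(inj_eq rk_inj) neq_ltn => /orP[lt|gt].
  exists end0, end1; rewrite ends0 ends1 e ge n01; split=> //.
  by rewrite andbT; apply/existsP; exists c; rewrite ec.
exists end0, end2; rewrite ends0 ends2 e le n02; split=> //.
by apply/existsP; exists c; rewrite ec.
Qed.

Lemma ends_full n : full ends n = mid n.1 n.2.
Proof.
apply/forallP/and3P => [en|[e lt gt] i].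
  have := en end0; have := en end1; have := en end2; rewrite ends0 ends1 ends2.
  by move=> /andP[_ ->] /andP[-> _] ->.
by case: (end_cases i) => ->; rewrite ?ends0 ?ends1 ?ends2 ?e // ?lt ?gt /=
  ?edge_ge_edge ?edge_le_edge.
Qed.

Lemma pres_endsE n : pres ends n = le_edge n.1 n.2 && ge_edge n.1 n.2.
Proof.
apply/existsP/idP => [[i /ends_pres //]|/andP[le ge]].
have [e|ne] := boolP (edge n.1 n.2); first by exists end0.
exists end1; rewrite ends1 ge andbT.
by move: le; rewrite le_edgeE (negbTE ne).
Qed.

Definition opp_end i : 'I_3 := if i == end1 then end2 else if i == end2 then end1 else i.

Lemma opp_endE : [/\ opp_end end0 = end0, opp_end end1 = end2 & opp_end end2 = end1].
Proof.
have [n01 n02 n12] := ends_neq.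
by rewrite /opp_end (negbTE n01) (negbTE n02) eqxx eq_sym (negbTE n12) eqxx.
Qed.

Definition nbr n i : A * (T * bool) :=
  if i == end0 then (tgt n.1 n.2, linv n.2)
  else if i == end1 then (n.1, prev n.2) else (n.1, next n.2).

(** An orientation of the blow-up: one end of each edge is positive ([nbr_end]). It depends only on
    the letter and the index, so it agrees under both maps from C. *)
Definition pos_end n i : bool := if i == end0 then ~~ n.2.2 else i == end2.

Lemma nbrE n : [/\ nbr n end0 = (tgt n.1 n.2, linv n.2), nbr n end1 = (n.1, prev n.2)
  & nbr n end2 = (n.1, next n.2)].
Proof.
have [n01 n02 n12] := ends_neq.
by rewrite /nbr eqxx !(eq_sym _ end0) (negbTE n01) (negbTE n02) eqxx eq_sym (negbTE n12).
Qed.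

Lemma pos_endE n : [/\ pos_end n end0 = ~~ n.2.2, pos_end n end1 = false
  & pos_end n end2 = true].
Proof.
have [n01 n02 n12] := ends_neq.
by rewrite /pos_end eqxx !(eq_sym _ end0) (negbTE n01) (negbTE n02) (negbTE n12) eqxx.
Qed.

Lemma nbr_end n i : ends n i ->
  [/\ ends (nbr n i) (opp_end i), nbr (nbr n i) (opp_end i) = n
    & pos_end (nbr n i) (opp_end i) = ~~ pos_end n i].
Proof.
have [o0 o1 o2] := opp_endE; have [b0 b1 b2] := nbrE n.
have [p0 p1 p2] := pos_endE n; case: n b0 b1 b2 p0 p1 p2 => v a /= b0 b1 b2 p0 p1 p2.
case: (end_cases i) => ->; rewrite ?ends0 ?ends1 ?ends2 ?b0 ?b1 ?b2 ?p0 ?p1 ?p2 ?o0 ?o1 ?o2.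
- move=> /= ea; have [c0 _ _] := nbrE (tgt v a, linv a).
  have [q0 _ _] := pos_endE (tgt v a, linv a).
  by rewrite c0 q0 /= ends0 edge_linv // tgtK // linvK.
- move=> /andP[/existsP[c /andP[/= ec ca]] /existsP[d /andP[/= ed ad]]].
  have [_ _ c2] := nbrE (v, prev a); have [_ _ q2] := pos_endE (v, prev a).
  rewrite c2 q2 /= (prevK ca) ends2; split=> //; apply/andP; split; apply/existsP.
    exists c; rewrite ec rk_prev -ltnS prednK //; exact: leq_ltn_trans ca.
  exists d; rewrite ed rk_prev /= (leq_trans _ ad) // prednK //; exact: leq_ltn_trans ca.
- move=> /andP[/existsP[d /andP[/= ed da]] /existsP[c /andP[/= ec ac]]].
  have [_ c1 _] := nbrE (v, next a); have [_ q1 _] := pos_endE (v, next a).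
  rewrite c1 q1 /= (nextK ac) ends1; split=> //; apply/andP; split; apply/existsP.
    by exists d; rewrite ed (rk_next ac) ltnS.
  by exists c; rewrite ec (rk_next ac).
Qed.

Section Coboundary.
Local Open Scope ring_scope.
Variables (phi : T -> 'F_2) (f : A * (T * bool) -> 'F_2).

(** The cocycle [phi] on letters plus the coboundary of [f]. Segments of the replacing paths carry
    no letter, so [phi] counts at [end0] only. *)
Definition cobound n i := (if i == end0 then phi n.2.1 else 0) + f n + f (nbr n i).

Lemma cobound_opp n i : ends n i -> cobound (nbr n i) (opp_end i) = cobound n i.
Proof.
move=> ei; have [_ nbrK _] := nbr_end ei.
rewrite /cobound nbrK -!addrA (addrC (f n)); congr (_ + _).
have [o0 o1 o2] := opp_endE; have [b0 b1 b2] := nbrE n; have [n01 n02 n12] := ends_neq.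
by case: (end_cases i) => ->; rewrite ?o0 ?o1 ?o2 ?b0 ?b1 ?b2 ?eqxx
  // !(eq_sym _ end0) (negbTE n01) (negbTE n02).
Qed.

Hypothesis deg : forall v : A, deg2 v.
Hypothesis closed : forall n i, ends n i -> cobound n i = 0.

Lemma cobound_eq0 n i : ends n i ->
  f (nbr n i) = f n + (if i == end0 then phi n.2.1 else 0).
Proof.
move/closed/eqP; rewrite /cobound addF2_eq0 => /eqP <-; exact: addrC.
Qed.

Lemma closed_vertex v a c : le_edge v a -> ge_edge v c -> (rk a <= rk c)%N ->
  f (v, c) = f (v, a).
Proof.
move=> le ge ac; have [m mE] : {m | m = rk c - rk a}%N by exists (rk c - rk a)%N.
elim: m a mE le ac => [|m IH] a mE le ac.
  suff -> : a = c by [].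
  by apply: rk_inj; apply/eqP; rewrite eqn_leq ac -subn_eq0 -mE.
have lt : (rk a < rk c)%N by rewrite -subn_gt0 -mE.
have rn := rk_next lt.
have e2 : ends (v, a) end2.
  rewrite ends2 le /=; case/existsP: ge => d /andP[ed cd]; apply/existsP; exists d.
  by rewrite ed (leq_trans lt).
have [_ _ b2] := nbrE (v, a); have [_ n02 _] := ends_neq.
have := cobound_eq0 e2; rewrite b2 eq_sym (negbTE n02) addr0 /= => <-.
apply: IH; rewrite ?rn //; first by rewrite subnS -mE.
by case/existsP: le => d /andP[ed da]; apply/existsP; exists d; rewrite ed rn ltnW.
Qed.

Lemma closed_edges v a c : edge v a -> edge v c -> f (v, a) = f (v, c).
Proof.
move=> ea ec; case/orP: (leq_total (rk a) (rk c)) => le.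
  by rewrite -(@closed_vertex v a c) // ?edge_le_edge ?edge_ge_edge.
by rewrite (@closed_vertex v c a) // ?edge_le_edge ?edge_ge_edge.
Qed.

(** When all [cobound] values vanish, [f] is a potential for [phi]: constant along each replacing
    path, and changing by [phi] across each letter. *)
Lemma closed_path v w a c : ok v w -> edge v a -> edge (run v w) c ->
  f (run v w, c) = f (v, a) + wsum phi w.
Proof.
elim: w v a => [|d w IH] v a /=.
  by move=> _ ea ec; rewrite wsum_nil addr0; apply: closed_edges.
move=> /andP[ed okw] ea ec; rewrite (IH _ (linv d)) ?edge_linv //.
have := @cobound_eq0 (v, d) end0 ed; have [b0 _ _] := nbrE (v, d).
by rewrite b0 eqxx /= => ->; rewrite wsum_cons addrA (@closed_edges v d a).
Qed.

Lemma closed_accepts v w : accepts v w -> wsum phi w = 0.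
Proof.
move=> /andP[okw /eqP runw]; have [a [_ [_ ea _]]] := deg v.
have := @closed_path v w a a okw ea; rewrite runw => /(_ ea) /eqP.
by rewrite -subr_eq0 opprD addrA subrr sub0r oppr_eq0 => /eqP.
Qed.

End Coboundary.
End BlowUp.

(** * The coequalizer over the product *)

Section Sum.
Variables (T : eqType) (A B : graph T).

Definition sum_edge (v : A + B) a :=
  match v with inl x => edge x a | inr y => edge y a end.

Definition sum_tgt (v : A + B) a : A + B :=
  match v with inl x => inl (tgt x a) | inr y => inr (tgt y a) end.

Fact sum_graph_linv v a : sum_edge v a -> sum_edge (sum_tgt v a) (linv a).
Proof. by case: v => v; exact: edge_linv. Qed.

Fact sum_graph_tgtK v a : sum_edge v a -> sum_tgt (sum_tgt v a) (linv a) = v.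
Proof. by case: v => v /= ea; rewrite tgtK. Qed.

Definition sum_graph : graph T := Graph sum_graph_linv sum_graph_tgtK.

Lemma sum_okl v w : ok (inl v : sum_graph) w = ok v w.
Proof. by elim: w v => [|a w IH] v //=; rewrite IH. Qed.

Lemma sum_okr v w : ok (inr v : sum_graph) w = ok v w.
Proof. by elim: w v => [|a w IH] v //=; rewrite IH. Qed.

Lemma sum_runl v w : run (inl v : sum_graph) w = inl (run v w).
Proof. by elim: w v => [|a w IH] v //=; rewrite IH. Qed.

Lemma sum_runr v w : run (inr v : sum_graph) w = inr (run v w).
Proof. by elim: w v => [|a w IH] v //=; rewrite IH. Qed.

End Sum.

Definition morph (T : eqType) (A B : graph T) (pi : A -> B) :=
  forall v a, edge v a -> edge (pi v) a /\ pi (tgt v a) = tgt (pi v) a.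

Section Morphism.
Variables (T : finType) (A B : graph T) (pi : A -> B).
Hypothesis piM : morph pi.

(** The blow-up is functorial because it uses only the order of the letters, which morphisms
    preserve. *)
Lemma morph_ends (v : A) a i : ends (v, a) i -> ends (pi v, a) i.
Proof.
have sub (P : pred (T * bool)) :
    [exists c, edge v c && P c] -> [exists c, edge (pi v) c && P c].
  by case/existsP=> c /andP[/piM[ec _] Pc]; apply/existsP; exists c; rewrite ec.
case: (end_cases i) => ->; rewrite ?ends0 ?ends1 ?ends2 /=; first by case/piM.
  by case/andP=> /sub ? /sub ?; apply/andP.
by case/andP=> /sub ? /sub ?; apply/andP.
Qed.

Lemma morph_nbr (v : A) a i : ends (v, a) i ->
  nbr (pi v, a) i = (pi (nbr (v, a) i).1, (nbr (v, a) i).2).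
Proof.
have [[b0 b1 b2] [c0 c1 c2]] := (nbrE (v, a), nbrE (pi v, a)).
case: (end_cases i) => ->; rewrite ?b0 ?b1 ?b2 ?c0 ?c1 ?c2 //.
by case/piM => _ /= ->.
Qed.

End Morphism.

Section LowerBound.
Variables (T : finType) (A B C : graph T) (pi1 : C -> A) (pi2 : C -> B).
Variables (vA : A) (vB : B) (vC : C).
Hypotheses (pi1M : morph pi1) (pi2M : morph pi2).
Hypotheses (pi1v : pi1 vC = vA) (pi2v : pi2 vC = vB).
Hypotheses (Aconn : connected vA) (Bconn : connected vB).
Hypotheses (Adeg : forall v : A, deg2 v) (Bdeg : forall v : B, deg2 v)
  (Cdeg : forall v : C, deg2 v).
Hypothesis detect : forall phi : T -> 'F_2,
  (forall w, accepts vA w -> wsum phi w = 0%R) ->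
  (forall w, accepts vB w -> wsum phi w = 0%R) -> forall x, phi x = 0%R.

Let AB := sum_graph A B.
Let N : finType := (AB * (T * bool))%type.
Let W : finType := (C * (T * bool))%type.

Definition srcA (w : W) : N := (inl (pi1 w.1), w.2).
Definition srcB (w : W) : N := (inr (pi2 w.1), w.2).

Lemma inl_pi1M : morph (fun v => inl (pi1 v) : AB).
Proof. by move=> v a /pi1M[ea E]; rewrite /edge /= ea E. Qed.

Lemma inr_pi2M : morph (fun v => inr (pi2 v) : AB).
Proof. by move=> v a /pi2M[ea E]; rewrite /edge /= ea E. Qed.

Lemma sum_deg2 (v : AB) : deg2 v.
Proof.
by case: v => v; [have [a [c [ac ea ec]]] := Adeg v | have [a [c [ac ea ec]]] := Bdeg v];
  exists a, c.
Qed.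

Let P : N -> pred 'I_3 := @ends T AB.
Let Q : W -> pred 'I_3 := @ends T C.

Lemma ends_src w i : Q w i -> P (srcA w) i && P (srcB w) i.
Proof.
case: w => v a Qi; apply/andP; split; first exact: (morph_ends inl_pi1M Qi).
exact: (morph_ends inr_pi2M Qi).
Qed.

Lemma ends_twoP n i : P n i -> two (P n).
Proof. by apply: ends_two; exact: sum_deg2. Qed.

Lemma ends_twoQ w i : Q w i -> two (Q w).
Proof. by apply: ends_two; exact: Cdeg. Qed.

Local Open Scope ring_scope.

Local Notation verts := (vert_funs srcA srcB P Q).

Lemma cobound_src (phi : T -> 'F_2) (f : {ffun N -> 'F_2}) w i : f \in verts -> Q w i ->
  cobound (A := AB) phi f (srcA w) i = cobound (A := AB) phi f (srcB w) i.
Proof.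
move=> /vert_funsP[_ fQ] Qi; case: w Qi => v a Qi.
have lk : link Q (v, a) by apply/existsP; exists i.
have [Qn _ _] := nbr_end Qi.
have lkn : link Q (nbr (v, a) i) by apply/existsP; exists (opp_end i).
rewrite /cobound /srcA /srcB /= (morph_nbr inl_pi1M Qi) (morph_nbr inr_pi2M Qi).
by rewrite (fQ _ lk) (fQ _ lkn).
Qed.

Definition const_fun : {ffun N -> 'F_2} := [ffun n => if pres P n then 1 else 0].

(** A potential forces [phi] to vanish on the loops of both graphs, hence everywhere by [detect].
    Then [f] is constant on each connected graph, and the link at [vC] makes the two constants
    equal. *)
Lemma cobound_kernel (phi : T -> 'F_2) (f : {ffun N -> 'F_2}) : f \in verts ->
  (forall n i, P n i -> cobound (A := AB) phi f n i = 0) ->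
  (forall x, phi x = 0) /\ (f = 0 \/ f = const_fun).
Proof.
move=> fv closed; have /vert_funsP[f0 fQ] := fv.
have phi0 : forall x, phi x = 0.
  apply: detect => w /andP[okw /eqP runw].
    apply: (closed_accepts sum_deg2 closed (v := inl vA)).
    by rewrite /accepts sum_okl sum_runl okw runw eqxx.
  apply: (closed_accepts sum_deg2 closed (v := inr vB)).
  by rewrite /accepts sum_okr sum_runr okw runw eqxx.
split=> //.
have [z [_ [_ ez _]]] := Cdeg vC.
have link_z : f (inl vA, z) = f (inr vB, z).
  by have := fQ (vC, z); rewrite /srcA /srcB /= pi1v pi2v; apply; apply/existsP; exists end0.
have [ezA _] := pi1M ez; have [ezB _] := pi2M ez; rewrite pi1v pi2v in ezA ezB.
have wsum0 w : wsum phi w = 0 by apply: big1 => a _; rewrite phi0.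
have fc (v : AB) a : edge v a -> f (v, a) = f (inl vA, z).
  case: v => v ev.
    have [w okw runw] := Aconn v.
    have := @closed_path _ _ _ _ closed (inl vA) w z a.
    by rewrite sum_okl sum_runl runw wsum0 addr0 => ->.
  have [w okw runw] := Bconn v.
  have := @closed_path _ _ _ _ closed (inr vB) w z a.
  by rewrite sum_okr sum_runr runw wsum0 addr0 link_z => ->.
have fpres n : pres P n -> f n = f (inl vA, z).
  case: n => v a; rewrite pres_endsE => /andP[/= le ge].
  have /existsP[c /andP[ec ac]] := ge.
  rewrite -(fc v c ec); symmetry.
  by apply: (closed_vertex closed) => //; apply: edge_ge_edge.
have [E|E] : f (inl vA, z) = 0 \/ f (inl vA, z) = 1.
  case: (f (inl vA, z)) => -[|[|//]] lt; [left|right]; exact: val_inj.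
- left; apply/ffunP => n; rewrite ffunE.
  by have [/fpres ->|/f0] := boolP (pres P n).
- right; apply/ffunP => n; rewrite ffunE.
  by case: ifP => [/fpres -> //|/negbT/f0].
Qed.

Let funs2 : finType := ({ffun N -> 'F_2} * {ffun N -> 'F_2})%type.
Let labels2 : finType := ({ffun T -> 'F_2} * {ffun T -> 'F_2})%type.

(* The ends of an edge get values from independent cocycles, so that no choice of
   an orientation of the quotient is needed. *)
Definition two_cocycles (x : labels2 * funs2) : {ffun N * 'I_3 -> 'F_2} :=
  [ffun e => if P e.1 e.2 then
     if pos_end (A := AB) e.1 e.2 then cobound (A := AB) x.1.1 x.2.1 e.1 e.2
     else cobound (A := AB) x.1.2 x.2.2 e.1 e.2
   else 0].

Lemma cobound_half (phi : T -> 'F_2) (f : {ffun N -> 'F_2}) b :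
  (forall n i, P n i -> pos_end (A := AB) n i = b -> cobound (A := AB) phi f n i = 0) ->
  forall n i, P n i -> cobound (A := AB) phi f n i = 0.
Proof.
move=> H n i Pi; have [E|E] := eqVneq (pos_end (A := AB) n i) b; first exact: H.
have [Pn _ pn] := nbr_end Pi.
rewrite -cobound_opp //; apply: H => //.
by rewrite pn; apply/eqP; rewrite -addbT; case: (pos_end _ _) E; case: b.
Qed.

Lemma coboundB (phi psi : {ffun T -> 'F_2}) (f g : {ffun N -> 'F_2}) n i :
  cobound (A := AB) (phi - psi) (f - g) n i
  = cobound (A := AB) phi f n i - cobound (A := AB) psi g n i.
Proof. by rewrite /cobound !ffunE; case: ifP => _; ring. Qed.

(** In exponents: edges minus vertices of the coequalizer is at least [#|T|] - 1, doubled. The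
    factor 4 is two constants for each of the two cocycles. *)
Lemma card_end_funs_ge :
  (2 ^ (2 * #|T|) * #|verts| ^ 2 <= 4 * #|end_funs srcA srcB P Q|)%N.
Proof.
pose D := finset.setX [set: labels2] (finset.setX verts verts).
pose consts : {set {ffun N -> 'F_2}} := [set f | f \in [:: 0; const_fun]].
pose K := finset.setX (finset.set1 ((0, 0) : labels2)) (finset.setX consts consts).
have consts2 : (#|consts| <= 2)%N.
  by rewrite cardsE; exact: card_size.
have K4 : (#|K| <= 4)%N.
  rewrite !cardsX cards1 mul1n.
  exact: (leq_mul consts2 consts2).
have <- : #|D| = (2 ^ (2 * #|T|) * #|verts| ^ 2)%N.
  rewrite !cardsX cardsT card_prod card_ffun card_Fp // mul2n -addnn expnD.
  by rewrite expnS expn1.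
apply: (@leq_trans (#|K| * #|end_funs srcA srcB P Q|)); last by rewrite leq_mul2r K4 orbT.
apply: (card_fibers (f := two_cocycles) (K := K)
  (d := fun x y => ((x.1.1 - y.1.1, x.1.2 - y.1.2), (x.2.1 - y.2.1, x.2.2 - y.2.2)))).
- move=> [[p1 p2] [f1 f2]]; rewrite !finset.in_setX /= => /and3P[_ v1 v2].
  apply/end_funsP; split=> [n i /negbTE nP|w i Qi]; first by rewrite ffunE nP.
  rewrite !ffunE /=; have /andP[-> ->] := ends_src Qi.
  by rewrite !(cobound_src _ _ Qi).
- move=> [[p1 p2] [f1 f2]] [[q1 q2] [g1 g2]]; rewrite !finset.in_setX /=.
  move=> /and3P[_ v1 v2] /and3P[_ u1 u2] /ffunP E.
  have diff_vert (f g : {ffun N -> 'F_2}) : f \in verts -> g \in verts -> f - g \in verts.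
    move=> /vert_funsP[f0 fQ] /vert_funsP[g0 gQ]; apply/vert_funsP; split=> [n np|w lw].
      by rewrite !ffunE f0 // g0 // subr0.
    by rewrite !ffunE fQ // gQ.
  have [r1 r2] : ((forall x, (p1 - q1) x = 0) /\ (f1 - g1 = 0 \/ f1 - g1 = const_fun)) /\
      ((forall x, (p2 - q2) x = 0) /\ (f2 - g2 = 0 \/ f2 - g2 = const_fun)).
    split; apply: cobound_kernel; try exact: diff_vert.
      apply: (cobound_half (b := true)) => n i Pi pi; rewrite coboundB.
      by have := E (n, i); rewrite !ffunE /= Pi pi => ->; rewrite subrr.
    apply: (cobound_half (b := false)) => n i Pi pi; rewrite coboundB.
    by have := E (n, i); rewrite !ffunE /= Pi pi => ->; rewrite subrr.
  have [[l1 c1] [l2 c2]] := (r1, r2).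
  have z1 : p1 - q1 = 0 by apply/ffunP => x; rewrite l1 ffunE.
  have z2 : p2 - q2 = 0 by apply/ffunP => x; rewrite l2 ffunE.
  rewrite /= z1 z2 finset.in_set1 eqxx /= !inE.
  by apply/andP; split; apply/orP; [case: c1|case: c2] => ->; rewrite eqxx; by [left|right].
- by move=> [[q1 q2] [g1 g2]] [[p1 p2] [f1 f2]] [[s1 s2] [h1 h2]] [] /addIr -> /addIr ->
    /addIr -> /addIr ->.
Qed.

End LowerBound.

(** * Counting pairs of trivalent vertices *)

(** Here [p] and [q] count the isolated and the other elements of [X], and [B] is the size of [Y].
    For [t] at most [p + 1] the truncated term is 0 and [p * B] alone suffices. *)
Lemma count_arith p q B t : p + q <= B -> t <= B + p -> 1 < t ->
  (p + q) * t <= 2 * (p * B + q * (t - 1 - p)).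
Proof.
move=> XB tB t1; have [->|p1] := posnP p.
  by case: t t1 {tB} => [|[|t]] // _; rewrite subn1 subn0 /=; nia.
have [tp|tp] := leqP t p.+1.
  have -> : t - 1 - p = 0 by lia.
  have pB : p * (p + q) <= p * B by rewrite leq_mul2l XB orbT.
  have : (p + q) * t <= (p + q) * (2 * p) by rewrite leq_mul2l; apply/orP; right; lia.
  by lia.
have [s sE] : exists s, t = p + s.+2 by exists (t - p - 2); lia.
have -> : t - 1 - p = s.+1 by lia.
have pB : p * (p + q) <= p * B by rewrite leq_mul2l XB orbT.
have ps : p * s.+2 <= p * B by rewrite leq_mul2l; apply/orP; right; lia.
by rewrite sE; nia.
Qed.

(* [D] is a set of functions on the disjoint union of [X] and [Y] that are constant along
   the relation [M], so [log2 #|D|] is at most the number of classes of [M]. *)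
Section Biadjacency.
Variables (U V S : finType) (X : {set U}) (Y : {set V}) (M : U -> V -> bool).
Variables (D : {set S}) (evU : S -> U -> 'F_2) (evV : S -> V -> 'F_2).
Hypothesis MXY : forall x y, M x y -> (x \in X) && (y \in Y).
Hypothesis evM : forall f x y, f \in D -> M x y -> evU f x = evV f y.
Hypothesis ev_inj : forall f g, f \in D -> g \in D -> {in X, evU f =1 evU g} ->
  {in Y, evV f =1 evV g} -> f = g.

Definition unrelated x := [set y in Y | ~~ M x y].
Definition isolated := [set x in X | [forall y, ~~ M x y]].

Lemma isolated_related x : x \in X -> x \notin isolated -> exists y, M x y.
Proof.
by move=> xX; rewrite inE xX /= negb_forall => /existsP[y]; rewrite negbK; exists y.
Qed.

(** The value at [x] (the summand 1) fixes all of [Y] related to [x]. Once [Y] is known, every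
    non-isolated element of [X] copies a related one. *)
Lemma card_le_unrelated x : x \in X -> #|D| <= 2 ^ (#|unrelated x| + 1 + #|isolated|).
Proof.
move=> xX; pose I : finType := ({y | y \in unrelated x} + unit + {x' | x' \in isolated})%type.
pose res f : {ffun I -> 'F_2} := [ffun i => match i with
  | inl (inl y) => evV f (val y) | inl (inr _) => evU f x | inr x' => evU f (val x') end].
suff resI : {in D &, injective res}.
  rewrite -(card_in_imset resI) (leq_trans (max_card _)) // card_ffun card_Fp //.
  by rewrite !card_sum !card_sig card_unit leqnn.
move=> f g fD gD /ffunP E.
have EY : {in Y, evV f =1 evV g}.
  move=> y yY; have [xy|nxy] := boolP (M x y).
    by rewrite -!(evM _ xy) //; have := E (inl (inr tt)); rewrite !ffunE.
  have yu : y \in unrelated x by rewrite inE yY.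
  by have := E (inl (inl (Sub y yu))); rewrite !ffunE /= ?SubK.
apply: ev_inj => // x' x'X; have [iso|/(isolated_related x'X)[y xy]] := boolP (x' \in isolated).
  by have := E (inr (Sub x' iso)); rewrite !ffunE /= ?SubK.
by rewrite !(evM _ xy) // EY //; case/andP: (MXY xy).
Qed.

Lemma card_le_isolated : #|D| <= 2 ^ (#|Y| + #|isolated|).
Proof.
pose I : finType := ({y | y \in Y} + {x | x \in isolated})%type.
pose res f : {ffun I -> 'F_2} := [ffun i => match i with
  | inl y => evV f (val y) | inr x => evU f (val x) end].
suff resI : {in D &, injective res}.
  rewrite -(card_in_imset resI) (leq_trans (max_card _)) // card_ffun card_Fp //.
  by rewrite !card_sum !card_sig leqnn.
move=> f g fD gD /ffunP E.
have EY : {in Y, evV f =1 evV g}.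
  by move=> y yY; have := E (inl (Sub y yY)); rewrite !ffunE /= ?SubK.
apply: ev_inj => // x xX; have [iso|/(isolated_related xX)[y xy]] := boolP (x \in isolated).
  by have := E (inr (Sub x iso)); rewrite !ffunE /= ?SubK.
by rewrite !(evM _ xy) // EY //; case/andP: (MXY xy).
Qed.

Lemma card_related :
  #|[set xy | M xy.1 xy.2]| + \sum_(x in X) #|unrelated x| = #|X| * #|Y|.
Proof.
rewrite (card_fst M) (bigID (mem X)) /= [X in _ + X + _]big1 ?addn0 => [|x xX]; last first.
  by apply: eq_card0 => y; rewrite inE; apply/negP => /MXY; rewrite (negbTE xX).
rewrite -big_split -sum_nat_const /=; apply: eq_bigr => x _.
rewrite -(cardsID [set y | M x y] Y); congr (_ + _); apply: eq_card => y.
  by rewrite !inE; case xy: (M x y); rewrite ?andbF //; case/andP: (MXY xy) => _ ->.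
by rewrite !inE andbC.
Qed.

(** An isolated element misses all of [Y], any other at least [t - 1 - p] elements. By [count_arith]
    the average is at least t/2, and there [#|X| <= #|Y|] enters. *)
Lemma related_bound t : 1 < t -> 2 ^ t <= #|D| -> #|X| <= #|Y| ->
  2 * #|[set xy | M xy.1 xy.2]| + #|X| * t <= 2 * (#|X| * #|Y|).
Proof.
move=> t1 tD XY; rewrite -card_related mulnDr leq_add2l.
set p := #|isolated|; pose q := #|X :\: isolated|.
have isoX : isolated \subset X by apply/fintype.subsetP => x; rewrite inE => /andP[].
have Xpq : #|X| = p + q.
  rewrite -(cardsID isolated X); congr (_ + _).
  by apply: eq_card => x; rewrite inE andbC; case xi: (x \in isolated) => //=;
    rewrite (fintype.subsetP isoX).
have tY : t <= #|Y| + p.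
  by have := leq_trans tD card_le_isolated; rewrite leq_exp2l.
have tu x : x \in X -> t <= #|unrelated x| + 1 + p.
  by move=> xX; have := leq_trans tD (card_le_unrelated xX); rewrite leq_exp2l.
have sum_ge : p * #|Y| + q * (t - 1 - p) <= \sum_(x in X) #|unrelated x|.
  rewrite (bigID (mem isolated)) /= -!sum_nat_const.
  rewrite [Z in _ <= Z + _](eq_bigl (fun x => x \in isolated)); last first.
    by move=> x; apply/andP/idP => [[]//|xi]; rewrite (fintype.subsetP isoX).
  rewrite [Z in _ <= _ + Z](eq_bigl (fun x => x \in X :\: isolated)); last first.
    by move=> x; rewrite finset.in_setD andbC.
  apply: leq_add; apply: leq_sum => x.
    rewrite inE => /andP[_ /forallP xiso]; apply/subset_leq_card/fintype.subsetP => y yY.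
    by rewrite inE yY xiso.
  by rewrite finset.in_setD => /andP[_ /tu]; lia.
apply: leq_trans (leq_mul (leqnn 2) sum_ge).
rewrite Xpq; apply: count_arith => //; by rewrite -Xpq.
Qed.

End Biadjacency.

Section MidBound.
Variables (T : finType) (A B C : graph T) (pi1 : C -> A) (pi2 : C -> B).
Variables (vA : A) (vB : B) (vC : C).
Hypotheses (pi1M : morph pi1) (pi2M : morph pi2).
Hypothesis pi_inj : injective (fun v => (pi1 v, pi2 v)).
Hypotheses (pi1v : pi1 vC = vA) (pi2v : pi2 vC = vB).
Hypotheses (Aconn : connected vA) (Bconn : connected vB).
Hypotheses (Adeg : forall v : A, deg2 v) (Bdeg : forall v : B, deg2 v)
  (Cdeg : forall v : C, deg2 v).
Hypothesis detect : forall phi : T -> 'F_2,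
  (forall w, accepts vA w -> wsum phi w = 0%R) ->
  (forall w, accepts vB w -> wsum phi w = 0%R) -> forall x, phi x = 0%R.

Let N : finType := (sum_graph A B * (T * bool))%type.
Let D : {set {ffun N -> 'F_2}} :=
  full_funs (srcA B pi1) (srcB A pi2) (@ends T (sum_graph A B)) (@ends T C).

Let lift_mid (w : C * (T * bool)) := ((pi1 w.1, w.2), (pi2 w.1, w.2)).
Let M x y := (x, y) \in lift_mid @: mids C.

Lemma morph_mid (A' : graph T) (pi : C -> A') v a : morph pi -> mid v a -> mid (pi v) a.
Proof.
move=> piM; rewrite -[mid v a](ends_full (v, a)) -[mid (pi v) a](ends_full (pi v, a)).
by move=> /forallP e; apply/forallP => i; apply: morph_ends (e i).
Qed.

(** Joint injectivity of the two projections makes trivalent vertices of C into distinct pairs. *)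
Lemma card_mids_related : #|[set xy | M xy.1 xy.2]| = #|mids C|.
Proof.
rewrite -(card_imset (mids C) (_ : injective lift_mid)).
  by apply: eq_card => -[x y]; rewrite inE.
by move=> [v a] [u c] [E1 -> E2 _]; congr (_, _); apply: pi_inj; rewrite E1 E2.
Qed.

Lemma related_mids x y : M x y -> (x \in mids A) && (y \in mids B).
Proof.
by case/imsetP=> -[v a]; rewrite inE => /= m [-> ->]; rewrite !inE /= !morph_mid.
Qed.

(** The two estimates of [end_funs] share the factor [#|vert_funs| ^ 2], which is positive because
    of the zero function and cancels. *)
Lemma card_full_funs_ge : 2 ^ (2 * #|T|) <= 4 * #|D|.
Proof.
have le1 := card_end_funs_ge pi1M pi2M pi1v pi2v Aconn Bconn Adeg Bdeg Cdeg detect.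
have le2 := card_end_funs_le (ends_src pi1M pi2M) (ends_twoP Adeg Bdeg) (ends_twoQ Cdeg).
set m := #|vert_funs _ _ _ _| in le1 le2.
have m0 : 0 < m ^ 2.
  rewrite expn_gt0 orbF; apply/card_gt0P; exists [ffun => 0%R].
  by apply/vert_funsP; split=> *; rewrite !ffunE.
rewrite -(leq_pmul2r m0) (leq_trans le1) // -mulnA leq_mul2l /= mulnC.
by rewrite mulnC in le2; rewrite mulnC.
Qed.

Lemma mids_bound : 0 < #|T| -> #|mids A| <= #|mids B| ->
  #|mids C| + #|mids A| * (#|T| - 1) <= #|mids A| * #|mids B|.
Proof.
(* For a cyclic join the subtracted term vanishes, and it suffices that related pairs are pairs. *)
move=> T0 AB; have [T1|T1] := leqP #|T| 1.
  have -> : #|T| - 1 = 0 by lia.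
  by rewrite muln0 addn0 -card_mids_related -(card_related related_mids) leq_addr.
suff : 2 * #|[set xy | M xy.1 xy.2]| + #|mids A| * (2 * (#|T| - 1))
    <= 2 * (#|mids A| * #|mids B|) by rewrite card_mids_related; nia.
pose evA (f : {ffun N -> 'F_2}) (x : A * (T * bool)) := f (inl x.1, x.2).
pose evB (f : {ffun N -> 'F_2}) (y : B * (T * bool)) := f (inr y.1, y.2).
apply: (related_bound (D := D) (evU := evA) (evV := evB)) => //.
- exact: related_mids.
- move=> f x y /full_funsP[_ fM] /imsetP[w wm [-> ->]]; rewrite inE in wm.
  by apply: fM; rewrite -[flink _ _]/(full (@ends T C) w) ends_full.
- move=> f g /full_funsP[f0 _] /full_funsP[g0 _] EA EB; apply/ffunP => -[[v|v] a].
    have [m|nm] := boolP (mid v a); first by apply: (EA (v, a)); rewrite inE.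
    by rewrite f0 ?g0 // ends_full.
  have [m|nm] := boolP (mid v a); first by apply: (EB (v, a)); rewrite inE.
  by rewrite f0 ?g0 // ends_full.
- by lia.
- have := card_full_funs_ge; have -> : 2 * #|T| = 2 + 2 * (#|T| - 1) by lia.
  by rewrite expnD leq_pmul2l.
Qed.

End MidBound.

(** * Choice of the basis and conclusion *)

Section CyclicBasis.
Local Open Scope group_scope.
Variables (G : groupType) (T : eqType) (J : set G).
Hypothesis sJ : subgroup J.
Implicit Types (b : T -> G) (w : seq (T * bool)).

Lemma free_family_mem b x : free_family b J -> J (b x).
Proof. by move=> [_ bJ]; apply/bJ; exists [:: (x, false)]; rewrite fval1. Qed.

Lemma fval_conj b g w : fval (fun x => g * b x / g) w = g * fval b w / g.
Proof.
elim: w => [|[x c] w IH]; first by rewrite !fval_nil mulg1 mulgV.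
rewrite !fval_cons IH !mulgA; congr (_ * _ / _).
rewrite /letter_val /=; case: c; last by rewrite mulgVK.
by rewrite !invgM invgK mulgA mulgVK.
Qed.

Lemma free_family_conj b g : J g -> free_family b J ->
  free_family (fun x => g * b x / g) J.
Proof.
move=> Jg [fw bJ]; split=> [u v ru rv|h].
  by rewrite !fval_conj => /mulIg/mulgI; apply: fw.
split=> [Jh|[w <-]].
  have /bJ[w Ew] : J (g^-1 * h * g).
    by apply: subgroupM => //; apply: subgroupM => //; apply: subgroupV.
  by exists w; rewrite fval_conj Ew !mulgA mulgV mul1g mulgK.
rewrite fval_conj; apply: subgroupM => //; last exact: subgroupV.
by apply: subgroupM => //; apply/bJ; exists w.
Qed.

(** If the outer letters cancel, conjugating the basis by the value of the first one spells the same
    element by the inner word. The conjugator lies in [J], so [J] and its subgroups stay as they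
    are. *)
Lemma cyclically_reduced_basis b w :
  free_family b J -> reduced w -> w <> [::] ->
  exists b' a w', [/\ free_family b' J, fval b' (a :: w') = fval b w,
    reduced (a :: w') & last a w' != linv a].
Proof.
have [n] := ubnP (size w); elim: n b w => [|n IH] b w // wn bJ redw wn0.
case: w redw wn wn0 => [|a w] // redw wn _.
have [E|ne] := eqVneq (last a w) (linv a); last by exists b, a, w.
case/lastP: w redw wn E => [|w c] redw wn.
  by move/eqP; rewrite eq_sym linv_neq.
rewrite last_rcons => Ec; rewrite Ec in redw wn *.
have redw' : reduced w.
  by move: redw; rewrite -cat1s => /reduced_cat[_]; rewrite -cats1 => /reduced_cat[].
have w0 : w <> [::].
  by move=> w0; move: redw; rewrite w0 /reduced /= eqxx.
pose g := letter_val (b a.1, a.2).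
have Jg : J g by case: bJ => _ bJ; apply/bJ; exists [:: a]; rewrite fval1.
have wn' : size w < n by move: wn; rewrite /= size_rcons; lia.
have [b' [a' [w' [b'J E' red' ne']]]] := IH _ w wn' (free_family_conj Jg bJ) redw' w0.
exists b', a', w'; split=> //; rewrite E' fval_conj fval_cons -/g -cats1 fval_cat fval1.
by rewrite letter_val_linv mulgA.
Qed.

End CyclicBasis.

Section FinitelyGenerated.
Local Open Scope group_scope.
Variable G : groupType.
Implicit Types (H J X : set G).

Lemma subgroup_range (T : eqType) (b : T -> G) :
  subgroup [set g | exists w, fval b w = g]%classic.
Proof.
apply/subgroupP; split=> [|_ _ [u <-] [w <-]]; first by exists [::]; rewrite fval_nil.
by exists (u ++ winv w); rewrite fval_cat fval_winv.
Qed.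

(** The basis of the whole group may be infinite, but words for finitely many generators use
    finitely many letters. *)
Lemma fin_gen_letters X J : free_basis [set: G]%classic X -> fin_gen J ->
  exists (T : finType) (b : T -> G),
    free_words b /\ forall g, J g -> exists w, fval b w = g.
Proof.
move=> fX [A /finite_seqP[s ->] <-]; have [_ _ Fsurj] := fX.
have /boolp.choice[wd wdE] : forall g, exists w, reduced_words X w /\ word_val w = g.
  by move=> g; have [|w Xw Ew] := Fsurj g; [|exists w].
pose l := flatten [seq [seq a.1 | a <- wd g] | g <- s].
exists (seq_sub l), val; split.
  apply: (basis_free_words fX) => [|[x /= /flattenP[_ /mapP[g gs ->] /mapP[a aw ->]]]].
    exact: val_inj.
  by have [[_ Xa] _] := wdE g; exact: Xa.
apply: gen_min; first exact: subgroup_range.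
move=> g /= gs; have [|w Ew] := @wmap_onto _ _ (val : seq_sub l -> G) (wd g).
  move=> a aw; have al : a.1 \in l.
    by apply/flattenP; exists [seq c.1 | c <- wd g]; exact: map_f.
  by exists (Sub a.1 al); rewrite SubK.
by exists w; rewrite -word_val_wmap Ew; case: (wdE g).
Qed.

Lemma fin_gen_core (T : finType) (b : T -> G) H :
  subgroup H -> fin_gen H -> free_words b -> (forall g, H g -> exists w, fval b w = g) ->
  exists (A : graph T) (v0 : A), [/\ recognizes b v0 H, trim v0 & connected v0].
Proof.
move=> sH fH bfree Hrange; have [A [v0 rec]] := fin_gen_automaton sH fH bfree Hrange.
exists (core_graph v0), (core_base v0); split; [|exact: core_trim|exact: core_connected].
by move=> w redw; rewrite core_accepts //; apply: rec.
Qed.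

(** First use of the automata, over letters of the ambient group. The basis obtained is, after
    conjugation, the alphabet for their second use. *)
Lemma fin_gen_free_family J : free_group G -> subgroup J -> fin_gen J ->
  exists (T : finType) (b : T -> G), free_family b J.
Proof.
move=> [X fX] sJ fJ; have [T [b [bfree Jrange]]] := fin_gen_letters fX fJ.
have [A [v0 [rec _ Aconn]]] := fin_gen_core sJ fJ bfree Jrange.
by have [I [c [cJ _]]] := automaton_free_family Aconn bfree Jrange rec; exists I, c.
Qed.

Lemma automaton_rank (T : finType) (A : graph T) (v0 : A) (b : T -> G) H :
  connected v0 -> (forall v : A, deg2 v) -> free_words b ->
  (forall g, H g -> exists w, fval b w = g) -> recognizes b v0 H ->
  exists2 n, has_rank H n & (#|mids A| + 2 = 2 * n)%N.
Proof.
move=> Aconn Adeg bfree Hrange rec.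
have [I [c [cH cardI]]] := automaton_free_family Aconn bfree Hrange rec.
exists #|I|; first exact: free_family_rank cH.
by have := card_mids Adeg; lia.
Qed.

Lemma has_rank_unique H n m : has_rank H n -> has_rank H m -> n = m.
Proof.
by move=> /rank_free_family[b bH] /(has_rank_card bH) ->; rewrite card_ord.
Qed.

End FinitelyGenerated.

Theorem theorem2 (F : groupType) (H K : set F) (h k : nat) :
  free_group F ->
  subgroup H -> subgroup K ->
  H <> [set 1%g]%classic -> K <> [set 1%g]%classic ->
  fin_gen H -> fin_gen K ->
  has_rank H h -> has_rank K k -> (h <= k)%N ->
  (H `&` K)%classic <> [set 1%g]%classic ->
  exists r j : nat,
    [/\ has_rank (H `&` K)%classic r,
        has_rank (join H K) j
      & (r%:Z - 1 <= 2 * (h%:Z - 1) * (k%:Z - 1)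
                     - (h%:Z - 1) * (j%:Z - 1))%R].
Proof.
move=> Ffree sH sK _ _ fH fK rH rK hk HK1.
have sJ : subgroup (join H K) := subgroup_gen _.
have [T [c cJ]] := fin_gen_free_family Ffree sJ (fin_gen_join fH fK).
have [z [Hz Kz z1]] : exists z, [/\ H z, K z & z <> 1%g].
  apply: contrapT => none; apply: HK1; apply/seteqP; split=> [x [Hx Kx]|_ ->].
    by apply: contrapT => x1; apply: none; exists x.
  by split; exact: subgroup1.
have HJ x : H x -> join H K x by move=> Hx; apply: sub_gen; left.
have KJ x : K x -> join H K x by move=> Kx; apply: sub_gen; right.
have [w Ew] : exists w, fval c w = z by have [_ Jc] := cJ; apply/Jc; exact: HJ.
have w1 : red w <> [::] by move=> w1; apply: z1; rewrite -Ew -fval_red w1 fval_nil.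
have [b [a [u [bJ bz redu nu]]]] := cyclically_reduced_basis sJ cJ (red_reduced w) w1.
rewrite fval_red Ew in bz; have [bfree Jb] := bJ.
have range (L : set F) : (forall x, L x -> join H K x) -> forall g, L g -> exists w, fval b w = g.
  by move=> LJ g /LJ/Jb.
have [A [vA [recA trimA connA]]] := fin_gen_core sH fH bfree (range _ HJ).
have [B [vB [recB trimB connB]]] := fin_gen_core sK fK bfree (range _ KJ).
pose AB := prod_graph A B; pose vAB : AB := (vA, vB).
pose C := core_graph vAB; pose vC : C := core_base vAB.
have recC : recognizes b vC (H `&` K)%classic.
  move=> x redx; rewrite core_accepts // prod_accepts; split.
    by move=> [/(recA _ redx) -> /(recB _ redx) ->].
  by case/andP=> /(recA _ redx) ? /(recB _ redx) ?; split.
(* The one cyclically reduced word for [z] is a loop in all three core graphs. *)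
have deg L (E : graph T) (v0 : E) : trim v0 -> connected v0 -> recognizes b v0 L ->
    L z -> forall v : E, deg2 v.
  by move=> Et Ec rec Lz; apply: (core_deg2 Et Ec _ nu); apply/rec => //; rewrite bz.
have Adeg := deg _ _ _ trimA connA recA Hz.
have Bdeg := deg _ _ _ trimB connB recB Kz.
have Cdeg := deg _ _ _ (@core_trim _ _ vAB) (@core_connected _ _ vAB) recC (conj Hz Kz).
have [h' rH' cardA] := automaton_rank connA Adeg bfree (range _ HJ) recA.
have [k' rK' cardB] := automaton_rank connB Bdeg bfree (range _ KJ) recB.
have [r rI cardC] := automaton_rank (@core_connected _ _ vAB) Cdeg bfree
  (range (H `&` K)%classic (fun x '(conj Hx _) => HJ x Hx)) recC.
rewrite -(has_rank_unique rH rH') in cardA; rewrite -(has_rank_unique rK rK') in cardB.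
exists r, #|T|; split=> //; first exact: free_family_rank bJ.
have T0 : 0 < #|T| by apply/card_gt0P; exists a.1.
pose pi1 (v : C) := (val v).1; pose pi2 (v : C) := (val v).2.
have pi1v : pi1 vC = vA by [].
have pi2v : pi2 vC = vB by [].
have piM (v : C) d : edge v d ->
    (edge (pi1 v) d /\ pi1 (tgt v d) = tgt (pi1 v) d) /\
    (edge (pi2 v) d /\ pi2 (tgt v d) = tgt (pi2 v) d).
  move=> ed; have /andP[e1 e2] := core_edge_edge ed.
  by rewrite /pi1 /pi2 (val_core_tgt ed).
have pi_inj : injective (fun v : C => (pi1 v, pi2 v)).
  by move=> v v' [E1 E2]; apply: val_inj; move: E1 E2; rewrite /pi1 /pi2;
    case: (val v) (val v') => [? ?] [? ?] /= -> ->.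
have detect (phi : T -> 'F_2) : (forall x, accepts vA x -> wsum phi x = 0%R) ->
    (forall x, accepts vB x -> wsum phi x = 0%R) -> forall x, phi x = 0%R.
  move=> phiA phiB x.
  (* The kernel of [phi] as a subgroup of the join. It contains [H] and [K], hence each [b x], and
     freeness turns this into [phi x = 0]. *)
  pose L : set F := [set g | exists2 y, fval b y = g & wsum phi y = 0%R]%classic.
  have sL : subgroup L.
    apply/subgroupP; split=> [|_ _ [y <- y0] [y' <- y0']].
      by exists [::]; rewrite ?fval_nil ?wsum_nil.
    by exists (y ++ winv y'); rewrite ?fval_cat ?fval_winv // wsum_cat wsum_winv y0 y0' addr0.
  have sub_L (E : graph T) (v0 : E) (L' : set F) :
      (forall x, L' x -> join H K x) -> recognizes b v0 L' ->
      (forall x, accepts v0 x -> wsum phi x = 0%R) -> (L' `<=` L)%classic.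
    move=> L'J rec acc0 g Lg; have [y Ey] := range _ L'J g Lg.
    exists (red y); first by rewrite fval_red.
    by apply: acc0; apply/rec; rewrite ?red_reduced // fval_red Ey.
  have [y Ey y0] : L (b x).
    apply: (@gen_min _ (H `|` K)%classic L sL); last exact: free_family_mem bJ.
    by move=> g [Hg|Kg]; [exact: sub_L HJ recA phiA _ Hg | exact: sub_L KJ recB phiB _ Kg].
  rewrite -[b x]/(letter_val (b (x, false).1, (x, false).2)) -fval1 in Ey.
  by rewrite -wsum_red (free_words_red bfree Ey) wsum_red wsum_cons wsum_nil addr0 in y0.
have AB_le : #|mids A| <= #|mids B| by lia.
have := mids_bound (fun v d e => (piM v d e).1) (fun v d e => (piM v d e).2) pi_inj
  pi1v pi2v connA connB Adeg Bdeg Cdeg detect T0 AB_le.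
(* The equations #|mids| + 2 = 2 rank make these ranks positive, and [T0] does so for the join;
   integer differences become natural numbers. *)
have [h0 h0E] : exists n, h = n.+1 by exists h.-1; lia.
have [k0 k0E] : exists n, k = n.+1 by exists k.-1; lia.
have [r0 r0E] : exists n, r = n.+1 by exists r.-1; lia.
have [j0 j0E] : exists n, #|T| = n.+1 by exists #|T|.-1; lia.
have -> : #|mids A| = 2 * h0 by lia.
have -> : #|mids B| = 2 * k0 by lia.
have -> : #|mids C| = 2 * r0 by move: cardC; rewrite -/C; lia.
rewrite h0E k0E r0E j0E subn1 /= => le2.
have le : r0 + h0 * j0 <= 2 * (h0 * k0) by nia.
have E (n : nat) : (n.+1%:Z - 1 = n%:Z)%R by lia.
rewrite !E; clear -le; nia.
Qed.
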